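(* Let $0<a<\infty$, $I=(-a,a)$, $q\in L^1(I)$, $L=\frac{d^2}{dx^2}-q$. Let $\{\varphi_k\}_{k\in\mathbb{N}_0}$ be a standard $L$-base such that $W(\varphi_0,\varphi_1)\neq0$ and let $\lambda\in\mathbb{C}$. Then the general weak solution of the equation $$v''-qv=\lambda v$$ on $I$ has the form $v=c_1v_1+c_2v_2$, where $c_1,c_2$ are arbitrary complex constants, $$v_1=\sum_{k=0}^\infty\lambda^k\frac{\varphi_{2k}}{(2k)!},\qquad v_2=\sum_{k=0}^\infty\lambda^k\frac{\varphi_{2k+1}}{(2k+1)!},$$ and both series, as well as the corresponding series of (first) derivatives, converge uniformly on $\overline I$.
   Context: All functions are complex valued; $\mathbb{N}_0=\{0,1,2,\dots\}$. Elements of $W^{2,1}(I)$ are identified with their $C^1(\overline I)$ representatives. $W(u,v)=uv'-u'v$ is the Wronskian (constant for two weak solutions of $u''=qu$). A weak solution of a second-order linear equation is a function in $W^{1,1}(I)$ satisfying it in the sense of distributions (equivalently, a function in $W^{2,1}(I)$ satisfying it a.e.). An $L$-base is a system $\{\varphi_k\}_{k\in\mathbb{N}_0}$ with $\varphi_k''-q\varphi_k=0$ for $k=0,1$ and $\varphi_k''-q\varphi_k=k(k-1)\varphi_{k-2}$ for $k\ge2$, in the sense of weak solutions. It is standard if $\varphi_k(0)=\varphi_k'(0)=0$ for all $k\ge2$. *)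

(* Defs.v *)
From HB Require Import structures.
From mathcomp Require Import all_boot all_order all_algebra.
From mathcomp Require Import complex.
From mathcomp Require Import all_classical all_reals all_analysis.

Set Implicit Arguments.
Unset Strict Implicit.
Unset Printing Implicit Defensive.

Import Order.TTheory GRing.Theory Num.Theory numFieldNormedType.Exports.
Local Open Scope classical_set_scope.
Local Open Scope ring_scope.

(* Throughout, I = ]-a, a[ with closure Ibar = `[-a, a], and functions on I or
   Ibar are total functions R -> R[i] whose values elsewhere are irrelevant.
   The regular algebra R[i]^o carries the usual topology of the complex
   plane. *)

Definition integrableC {R : realType} (a : R) (f : R -> R[i]) : Prop :=
  (@lebesgue_measure R).-integrable `]- a, a[
    (EFin \o (fun x => complex.Re (f x))) /\
  (@lebesgue_measure R).-integrable `]- a, a[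
    (EFin \o (fun x => complex.Im (f x))).

Definition integralC {R : realType} (a : R) (f : R -> R[i]) : R[i] :=
  Complex (\int[@lebesgue_measure R]_(x in `]- a, a[) complex.Re (f x))
          (\int[@lebesgue_measure R]_(x in `]- a, a[) complex.Im (f x)).

(* Real-valued test functions suffice: pairing with complex-valued ones is
   determined by complex linearity. *)
Definition test_function {R : realType} (a : R) (p : R -> R) : Prop :=
  (forall n x, derivable (derive1n n p) x 1) /\
  exists K : set R, [/\ compact K, K `<=` `]- a, a[ &
    forall x, ~ K x -> p x = 0].

Definition weak_derivative {R : realType} (a : R) (u g : R -> R[i]) : Prop :=
  forall p, test_function a p ->
    integralC a (fun x => u x * (derive1 p x)%:C%C) =
    - integralC a (fun x => g x * (p x)%:C%C).

Definition sobolev11 {R : realType} (a : R) (u : R -> R[i]) : Prop :=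
  integrableC a u /\ exists g, integrableC a g /\ weak_derivative a u g.

(* u is a weak solution of u'' - q u = f on I. The product q u is in L^1(I)
   because W^{1,1}(I) functions are essentially bounded. *)
Definition weak_solution {R : realType} (a : R) (q f u : R -> R[i]) : Prop :=
  sobolev11 a u /\
  forall p, test_function a p ->
    integralC a (fun x => u x * (derive1n 2 p x)%:C%C)
      - integralC a (fun x => q x * u x * (p x)%:C%C) =
    integralC a (fun x => f x * (p x)%:C%C).

(* Derivatives on Ibar are taken within Ibar: one-sided at -a and a. *)
Definition diff_quot {R : realType} (u : R -> R[i]) (x y : R) : R[i]^o :=
  (u y - u x) / (y - x)%:C%C.

Definition derivI {R : realType} (a : R) (u : R -> R[i]) (x : R) : R[i]^o :=
  lim (diff_quot u x y @[y --> within `[- a, a] x^']).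

Definition C1I {R : realType} (a : R) (u : R -> R[i]) : Prop :=
  (forall x, x \in `[- a, a] ->
     cvg (diff_quot u x y @[y --> within `[- a, a] x^'])) /\
  {within `[- a, a], continuous (derivI a u)}.

(* A weak solution identified with its representative in C^1(Ibar). *)
Definition C1_weak_solution {R : realType} (a : R) (q f u : R -> R[i]) : Prop :=
  C1I a u /\ weak_solution a q f u.

Definition wronskian {R : realType} (a : R) (u v : R -> R[i]) (x : R) : R[i] :=
  u x * derivI a v x - derivI a u x * v x.

Definition L_base {R : realType} (a : R) (q : R -> R[i])
    (phi : nat -> R -> R[i]) : Prop :=
  [/\ C1_weak_solution a q (fun=> 0) (phi 0%N),
      C1_weak_solution a q (fun=> 0) (phi 1%N) &
      forall k, (2 <= k)%N ->
        C1_weak_solution a q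
          (fun x => (k * (k - 1))%N%:R * phi (k - 2)%N x) (phi k)].

Definition standard_L_base {R : realType} (a : R) (q : R -> R[i])
    (phi : nat -> R -> R[i]) : Prop :=
  L_base a q phi /\
  forall k, (2 <= k)%N -> phi k 0 = 0 /\ derivI a (phi k) 0 = 0.

(* Partial sums of \sum_k lambda^k u_(2k+j) / (2k+j)!; here j is 0 or 1, and
   u is an L-base or the family of its derivatives. *)
Definition spps_partial {R : realType} (lambda : R[i]) (u : nat -> R -> R[i])
    (j n : nat) (x : R) : R[i]^o :=
  \sum_(0 <= k < n) lambda ^+ k * (u (2 * k + j)%N x / ((2 * k + j)`!)%:R).

Definition spps {R : realType} (lambda : R[i]) (u : nat -> R -> R[i])
    (j : nat) (x : R) : R[i]^o :=
  lim (spps_partial lambda u j n x @[n --> \oo]).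

Definition spps_uniform {R : realType} (a : R) (lambda : R[i])
    (u : nat -> R -> R[i]) (j : nat) : Prop :=
  {uniform `[- a, a], spps_partial lambda u j @ \oo --> spps lambda u j}.

(* Main.v *)
Require Import Defs.
From HB Require Import structures.
From mathcomp Require Import all_boot all_order all_algebra.
From mathcomp Require Import complex.
From mathcomp Require Import all_classical all_reals all_analysis.
From mathcomp Require Import measurable_realfun ring lra.

Set Implicit Arguments.
Unset Strict Implicit.
Unset Printing Implicit Defensive.

Import Order.TTheory GRing.Theory Num.Theory numFieldNormedType.Exports.
Local Open Scope classical_set_scope.
Local Open Scope ring_scope.

(** Two ideas carry the proof: weak solutions are handled as primitives of
integrable functions, and the whole series is controlled by one weighted
estimate.

Weak solutions. [cprimitive a u v] says that u(y) - u(x) is the integral of v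
over ]x, y[ for all x <= y in [-a, a]. A weak solution of u'' - q u = f
coincides almost everywhere with some u for which v exists with u a primitive
of v and v a primitive of q u + f, and conversely
([weak_solution_cprimitive], [cprimitive_weak_solution]). One direction is
integration by parts against test functions, a case of the product rule
[primitiveM]. The other one is the lemma of du Bois-Reymond
([du_Bois_Reymond]): a function whose distributional derivative vanishes is
constant. It is tested on smoothed trapezoids, whose derivatives tend to the
difference of the indicators of two intervals of the same length, and
Lebesgue's differentiation theorem concludes. A representative in C^1 is then
determined everywhere on [-a, a], and its derivative is the function v
([C1_weak_solution_cprimitive]).

The estimate. Below, |c| is the l^1 norm of a complex number c. If u is a
primitive of v and v of r u + z, with u(0) = v(0) = 0, then |u| + |v| is
compared with the weight exp(N m(x)), where m(x) is the integral of 1 + |r| (or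
of a larger density) between 0 and x. The integral of density times weight
between 0 and x is at most weight / N, so the equation gains a factor 1 / N at
each use: a bound B * weight on |z| yields the bound B / (N - 1) * weight on
|u| + |v| ([bielecki_estimate]). For z = 0 this gives
uniqueness in the Cauchy problem at 0 ([cauchy_unique]), also for the equation
with the spectral parameter.

The series. Since phi_m / m! solves y'' - q y = phi_(m-2) / (m-2)! with zero
Cauchy data at 0 when m >= 2, the estimate bounds the k-th term of each series,
together with its derivative, by a constant times (N - 1)^(-k). Taking
N = 2 + 2 |lambda| makes lambda^k times this term O(2^(-k)), whence uniform
convergence of both series. Partial sums satisfy
S_(n+1)'' = q S_(n+1) + lambda S_n, and primitives pass to uniform limits
([cprimitive_limit]); hence the sums solve v'' - q v = lambda v, with the
Cauchy data of phi_0 and phi_1 at 0 ([spps_spec]).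

General solution. If the Wronskian of phi_0 and phi_1 vanished at 0, a
nontrivial combination of phi_0 and phi_1 would have zero Cauchy data at 0,
hence vanish identically, and the Wronskian would vanish everywhere
([wronskian_at0]). So c1 and c2 can be chosen to match the Cauchy data at 0 of
a given solution, and uniqueness gives equality. *)

(** * Primitives of integrable functions on an interval *)

Section AlmostEverywhere.
Context {R : realType}.
Notation mu := (@lebesgue_measure R).

Lemma ae_impl (P Q : R -> Prop) : (forall x, P x -> Q x) ->
  {ae mu, forall x, P x} -> {ae mu, forall x, Q x}.
Proof.
by move=> PQ; apply: filterS => //; exact: (ae_filter_ringOfSetsType mu).
Qed.

Lemma ae_and (P Q : R -> Prop) : {ae mu, forall x, P x} ->
  {ae mu, forall x, Q x} -> {ae mu, forall x, P x /\ Q x}.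
Proof.
by move=> Px Qx; apply: filterI => //; exact: (ae_filter_ringOfSetsType mu).
Qed.

End AlmostEverywhere.

Section RealPrimitives.
Context {R : realType}.
Notation mu := (@lebesgue_measure R).
Variable a : R.
Implicit Types (f g h F G H : R -> R) (x y : R).

Definition integrableI f : Prop := mu.-integrable `]- a, a[ (EFin \o f).

(** Absolute continuity on [-a, a], in integrated form: this is the relation that
weak derivatives provide, and it passes to uniform limits. *)
Definition primitive F f : Prop :=
  integrableI f /\ forall x y, - a <= x -> x <= y -> y <= a ->
    F y - F x = \int[mu]_(t in `]x, y[) f t.

Lemma integrableI_sub f x y : integrableI f -> - a <= x -> y <= a ->
  mu.-integrable `]x, y[ (EFin \o f).
Proof.
move=> fi ax ya; apply: integrableS fi => //.
by apply: subset_itvW.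
Qed.

Lemma eq_primitive F F' f f' :
  (forall x, - a <= x -> x <= a -> F x = F' x) ->
  (forall x, - a < x -> x < a -> f x = f' x) ->
  primitive F f -> primitive F' f'.
Proof.
move=> FF ff [fi Ff]; split.
  apply: eq_integrable fi => // x; rewrite inE/= in_itv/= => /andP[? ?].
  by rewrite ff.
move=> x y ax xy ya; rewrite -!FF ?(le_trans ax) ?(le_trans _ ya)//.
rewrite Ff//; apply: eq_Rintegral => t; rewrite inE/= in_itv/= => /andP[? ?].
by rewrite ff// ?(le_lt_trans ax)// (lt_le_trans _ ya).
Qed.

Lemma integrableID f g : integrableI f -> integrableI g ->
  integrableI (fun x => f x + g x).
Proof. by move=> fi gi; have := integrableD _ fi gi; apply. Qed.

Lemma integrableIZ (c : R) f : integrableI f -> integrableI (fun x => c * f x).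
Proof. by move=> fi; have := integrableZl _ c fi; apply. Qed.

Lemma integralID f g : integrableI f -> integrableI g ->
  \int[mu]_(x in `]- a, a[) (f x + g x) =
  \int[mu]_(x in `]- a, a[) f x + \int[mu]_(x in `]- a, a[) g x.
Proof. by move=> fi gi; rewrite RintegralD. Qed.

Lemma integralIZ (c : R) f : integrableI f ->
  \int[mu]_(x in `]- a, a[) (c * f x) = c * \int[mu]_(x in `]- a, a[) f x.
Proof. by move=> fi; rewrite RintegralZl. Qed.

Lemma primitiveD F f G g : primitive F f -> primitive G g ->
  primitive (F \+ G) (f \+ g).
Proof.
move=> [fi Ff] [gi Gg]; split.
  exact: integrableID.
move=> x y ax xy ya; rewrite RintegralD//; try exact: integrableI_sub.
by rewrite -Ff// -Gg//=; ring.
Qed.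

Lemma primitiveZ (c : R) F f : primitive F f ->
  primitive (fun x => c * F x) (fun x => c * f x).
Proof.
move=> [fi Ff]; split.
  exact: integrableIZ.
move=> x y ax xy ya; rewrite RintegralZl//; last exact: integrableI_sub.
by rewrite -Ff// mulrBr.
Qed.

Lemma primitiveN F f : primitive F f -> primitive (\- F) (\- f).
Proof.
move=> /(primitiveZ (-1)); apply: eq_primitive => x _ _ /=; by rewrite mulN1r.
Qed.

Lemma primitiveB F f G g : primitive F f -> primitive G g ->
  primitive (F \- G) (f \- g).
Proof. by move=> Ff /primitiveN; exact: primitiveD. Qed.

Lemma integrableI_cst (c : R) : integrableI (cst c).
Proof.
apply: measurable_bounded_integrable => //.
  by rewrite /= lebesgue_measure_itv/=; case: ifP => //; rewrite -EFinB ltry.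
exact: bounded_cst.
Qed.

Lemma primitive_cst (c : R) : primitive (cst c) (cst 0).
Proof.
split; first exact: integrableI_cst.
by move=> x y _ _ _; rewrite subrr Rintegral_cst// mul0r.
Qed.

Lemma primitive_id : primitive id (cst 1).
Proof.
split; first exact: integrableI_cst.
move=> x y _ xy _; rewrite Rintegral_cst// mul1r /= lebesgue_measure_itv/= lte_fin.
case: ltP => //= yx; have -> : y = x by lra.
by rewrite subrr.
Qed.

(** The triangle inequality for integrals; it is stated for primitives because
most estimates below compare increments. *)
Lemma le_primitive H h B b x y : primitive H h -> primitive B b ->
  - a <= x -> x <= y -> y <= a ->
  (forall t, x < t -> t < y -> `|h t| <= b t) -> `|H y - H x| <= B y - B x.
Proof.
move=> [hi Hh] [bi Bb] ax xy ya hb; rewrite Hh// Bb//.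
have hi' := integrableI_sub hi ax ya.
apply: (le_trans (le_normr_Rintegral _ hi')) => //.
apply: le_Rintegral => //; first exact: integrable_norm.
  exact: integrableI_sub.
by move=> t /=; rewrite in_itv/= => /andP[]; exact: hb.
Qed.

Lemma integrableI_norm f : integrableI f -> integrableI (fun x => `|f x|).
Proof. exact: integrable_norm. Qed.

Lemma integrable_restrictI f D : measurable D -> integrableI f ->
  mu.-integrable D (EFin \o (f \_ `]- a, a[)).
Proof.
move=> mD fi; apply: (@integrableS _ _ _ _ setT) => //.
by rewrite -restrict_EFin; apply: (proj1 (integrable_mkcond _ _)).
Qed.

(** The restriction of f to the open interval is integrable on the whole line, as
Lebesgue's differentiation theorem requires. *)
Definition antideriv f x := \int[mu]_(t in `[- a, x]) (f \_ `]- a, a[) t.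

Lemma antiderivP f : integrableI f -> primitive (antideriv f) f.
Proof.
move=> fi; split=> // x y ax xy ya.
have ir D mD := @integrable_restrictI f D mD fi.
rewrite /antideriv (@Rintegral_itvB _ _ (BLeft (- a)) (BRight y) x)//.
- rewrite -Rintegral_itv_bndo_bndc; last exact: ir.
  apply: eq_Rintegral => t; rewrite inE/= in_itv/= => /andP[xt ty].
  rewrite patchE ifT// inE/= in_itv/= (le_lt_trans ax)//=.
  exact: lt_le_trans ya.
- exact: ir.
Qed.

(** An epsilon-delta form of continuity on [-a, a]; [continuousIP] relates it to
the subspace topology. *)
Definition continuousI F := forall c, - a <= c -> c <= a -> forall e, 0 < e ->
  exists2 d, 0 < d & forall t, - a <= t -> t <= a -> `|t - c| < d ->
    `|F t - F c| < e.


Lemma continuousIP F : continuousI F <-> {within `[- a, a], continuous F}.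
Proof.
split=> [cF|/subspace_continuousP cF c ac ca e e0].
  apply/subspace_continuousP => c /=; rewrite in_itv/= => /andP[ac ca].
  apply/cvgrPdist_lt => e e0; have [d d0 dF] := cF c ac ca e e0.
  rewrite near_withinE; near=> t.
  rewrite /= in_itv/= => /andP[at_ ta]; rewrite distrC dF//.
have /= := cF c; rewrite in_itv/= ac ca => /(_ isT)/cvgrPdist_lt/(_ e e0).
rewrite near_withinE => -[d /= d0 dF]; exists d => // t at_ ta td.
rewrite distrC; apply: dF => /=; first by rewrite distrC.
by rewrite in_itv/= at_ ta.
Unshelve. all: by end_near. Qed.

Lemma eq_continuousI F G : (forall x, - a <= x -> x <= a -> F x = G x) ->
  continuousI F -> continuousI G.
Proof.
move=> FG cF c ac ca e e0; have [d d0 dF] := cF c ac ca e e0.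
by exists d => // t at_ ta td; rewrite -!FG// dF.
Qed.

Lemma primitive_antideriv F f x : primitive F f -> - a <= x -> x <= a ->
  F x = F (- a) + antideriv f x.
Proof.
move=> Ff ax xa; have [fi _] := Ff; have Gf := antiderivP fi.
have [_ /(_ (- a) x)] := Ff; have [_ /(_ (- a) x)] := Gf.
rewrite {2}/antideriv set_itv1 Rintegral_set1 subr0 => -> // <- //.
by rewrite addrC subrK.
Qed.

Lemma primitive_continuous F f : 0 <= a -> primitive F f -> continuousI F.
Proof.
move=> a0 Ff; have [fi _] := Ff.
apply: (@eq_continuousI (fun x => F (- a) + antideriv f x)).
  by move=> x ax xa; rewrite -primitive_antideriv.
move=> c ac ca e e0.
have naa : - a <= a by lra.
have := parameterized_integral_continuous naa
  (@integrable_restrictI f `[- a, a] (measurable_itv _) fi).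
move=> /(proj2 (continuousIP _))/(_ c ac ca e e0)[d d0 dF].
by exists d => // t at_ ta td; rewrite opprD addrACA subrr add0r; exact: dF.
Qed.

Lemma continuousI_cst c : continuousI (cst c).
Proof. by move=> x _ _ e e0; exists 1 => // t _ _ _; rewrite subrr normr0. Qed.

Lemma continuousI_bounded F : 0 <= a -> continuousI F ->
  exists2 M, 0 < M & forall x, - a <= x -> x <= a -> `|F x| <= M.
Proof.
move=> a0 /continuousIP cF.
have [M [_ FM]] := compact_bounded (continuous_compact cF (@segment_compact _ _ _)).
exists (`|M| + 1); first by rewrite ltr_wpDl.
move=> x ax xa; apply: (FM (`|M| + 1)).
  by rewrite ltr_pwDr// ler_norm.
by exists x => //=; rewrite in_itv/= ax xa.
Qed.

Lemma continuousI_measurable F : continuousI F ->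
  measurable_fun `]- a, a[ F.
Proof.
move=> /continuousIP cF; apply: (@measurable_funS _ _ _ _ `[- a, a]) => //.
  exact: subset_itv_oo_cc.
exact: subspace_continuous_measurable_fun.
Qed.

Lemma continuousI_boundedP F : 0 <= a -> continuousI F ->
  [bounded F x | x in `]- a, a[].
Proof.
move=> a0 cF; have [M M0 FM] := continuousI_bounded a0 cF.
exists M; split; first exact: num_real.
move=> N MN x /=; rewrite in_itv/= => /andP[/ltW ax /ltW xa].
exact: (le_trans (FM _ ax xa) (ltW MN)).
Qed.

Lemma integrableI_mul F f : 0 <= a -> continuousI F -> integrableI f ->
  integrableI (fun x => F x * f x).
Proof.
move=> a0 cF fi.
rewrite /integrableI (_ : EFin \o _ = ((EFin \o F) \* (EFin \o f))%E)//.
apply: integrableMr => //; first exact: continuousI_measurable.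
exact: continuousI_boundedP.
Qed.

Lemma continuousI_integrable F : 0 <= a -> continuousI F -> integrableI F.
Proof.
move=> a0 cF; have := integrableI_mul a0 cF (integrableI_cst 1).
by apply: eq_integrable => // x _ /=; rewrite mulr1.
Qed.

(** A substitute for the fundamental theorem of calculus which does not mention
derivatives: increments of D that are locally negligible with respect to those
of a nondecreasing B force D to be constant. For fixed e, let c be the supremum
of the points t with |D t - D x| <= e (B t - B x); the local hypothesis at c
propagates this bound to c and beyond it. *)
Lemma small_increments (D B : R -> R) x y : - a <= x -> x <= y -> y <= a ->
  (forall u v, x <= u -> u <= v -> v <= y -> B u <= B v) ->
  (forall c, x <= c -> c <= y -> forall e, 0 < e -> exists2 d, 0 < d &
     forall u v, x <= u -> u <= v -> v <= y -> c - d < u -> v < c + d ->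
       `|D v - D u| <= e * (B v - B u)) ->
  D x = D y.
Proof.
move=> ax xy ya Bm loc.
suff key e : 0 < e -> `|D y - D x| <= e * (B y - B x).
  apply/esym/eqP; rewrite -subr_eq0 -normr_le0; apply/ler_addgt0Pl => e e0.
  have BB : 0 <= B y - B x by rewrite subr_ge0 Bm.
  have e'0 : 0 < e / (B y - B x + 1) by rewrite divr_gt0// ltr_wpDl.
  apply: (le_trans (key _ e'0)).
  rewrite addr0 mulrAC ler_pdivrMr ?ltr_wpDl//.
  by rewrite ler_wpM2l ?lerDl// ltW.
move=> e0.
pose S := [set t | x <= t /\ t <= y /\ `|D t - D x| <= e * (B t - B x)].
have Sx : S x by split=> //; split=> //; rewrite !subrr normr0 mulr0.
have hS : has_sup S by split; [exists x|exists y => t [_ []]].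
pose c := sup S.
have xc : x <= c by apply: ub_le_sup => //; case: hS.
have cy : c <= y by apply: ge_sup => [|t [_ []]//]; exists x.
have [d d0 dD] := loc c xc cy e e0.
have join u v : S u -> u <= v -> v <= y -> c - d < u -> v < c + d -> S v.
  move=> [xu [uy uD]] uv vy cu vc; split; first exact: le_trans uv.
  split=> //; rewrite (_ : D v - D x = (D v - D u) + (D u - D x)); last by ring.
  apply: (le_trans (ler_normD _ _)).
  by have := dD u v xu uv vy cu vc; lra.
have [u Su cu] := sup_adherent d0 hS.
have uc : u <= c by apply: ub_le_sup => //; case: hS.
have Sc : S c by apply: (join u) => //; lra.
have [yc|cy'] := leP y c.
  by have -> : y = c by [lra]; case: Sc => _ [].
(* If c < y, the bound extends past c, against the choice of c. *)
pose v := Num.min y (c + d / 2).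
have cv : c < v by rewrite lt_min cy'/=; lra.
have Sv : S v.
  apply: (join c) => //; first exact: ltW.
  - by rewrite ge_min lexx.
  - by lra.
  - by rewrite gt_min; apply/orP; right; lra.
have : v <= c by apply: ub_le_sup => //; case: hS.
by rewrite leNgt cv.
Qed.

End RealPrimitives.

(** * Product and exponential rules for primitives *)

Section Rules.
Context {R : realType}.
Notation mu := (@lebesgue_measure R).
Variable a : R.
Hypothesis a0 : 0 <= a.
Implicit Types (f g h F G H K B Q : R -> R) (x y : R).
Local Notation primitive := (primitive a).
Local Notation continuousI := (continuousI a).

Lemma primitive_monotone B b x y : primitive B b -> (forall t, 0 <= b t) ->
  - a <= x -> x <= y -> y <= a -> B x <= B y.
Proof.
move=> Bb b0 ax xy ya; rewrite -subr_ge0.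
have := le_primitive (primitive_cst a 0) Bb ax xy ya.
by rewrite /= subrr normr0; apply=> t _ _; exact: b0.
Qed.

(** To recognize H as a primitive of k, it suffices to compare its increments to
those of a known primitive K, up to errors that are small with respect to the
increments of some B. *)
Lemma primitive_local H K k B b : primitive K k -> primitive B b ->
  (forall t, 0 <= b t) ->
  (forall c, - a <= c -> c <= a -> forall e, 0 < e -> exists2 d, 0 < d &
     forall u v, - a <= u -> u <= v -> v <= a -> c - d < u -> v < c + d ->
       `|H v - H u - (K v - K u)| <= e * (B v - B u)) ->
  primitive H k.
Proof.
move=> Kk Bb b0 loc; split; first by case: Kk.
move=> x y ax xy ya; have [_ <-//] := Kk.
apply/eqP; rewrite eq_sym -subr_eq -eqr_opp; apply/eqP.
suff : (H \- K) x = (H \- K) y by rewrite /=; lra.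
apply: (@small_increments _ a _ B) => //.
  move=> u v xu uv vy; apply: (primitive_monotone Bb) => //.
    exact: le_trans xu.
  exact: le_trans ya.
move=> c xc cy e e0.
have [d d0 dl] := loc c (le_trans ax xc) (le_trans cy ya) e e0.
exists d => // u v xu uv vy cu vc.
have := dl u v (le_trans ax xu) uv (le_trans vy ya) cu vc.
by congr (`|_| <= _); rewrite /=; ring.
Qed.

Lemma continuousI_osc F : continuousI F ->
  forall c, - a <= c -> c <= a -> forall e, 0 < e -> exists2 d, 0 < d &
    forall s t, - a <= s -> s <= a -> c - d < s -> s < c + d ->
      - a <= t -> t <= a -> c - d < t -> t < c + d -> `|F s - F t| <= e.
Proof.
move=> cF c ac ca e e0; have [d d0 dF] := cF c ac ca (e / 2) ltac:(lra).
exists d => // s t ax xa cx xc ay ya cy yc.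
have h u : - a <= u -> u <= a -> c - d < u -> u < c + d -> `|F u - F c| < e / 2.
  by move=> au ua cu uc; apply: dF => //; rewrite ltr_norml; apply/andP; lra.
have := h _ ax xa cx xc; have := h _ ay ya cy yc.
rewrite !ltr_norml ler_norml => /andP[? ?] /andP[? ?]; apply/andP; lra.
Qed.

Lemma continuousI_comp (f : R -> R) F : continuous f -> continuousI F ->
  continuousI (f \o F).
Proof.
move=> cf cF c ac ca e e0.
have /cvgrPdist_lt/(_ e e0)[d /= d0 df] := cf (F c).
have [d' d'0 dF] := cF c ac ca d d0.
exists d' => // t at_ ta td; rewrite distrC; apply: df => /=.
by rewrite distrC; exact: dF.
Qed.

(** On a short interval [u, v], the increment of F G is G v (F v - F u) +
F u (G v - G u); freezing G at v and F at u in the integral of f G + F g costs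
at most e times the integral of |f| + |g|. *)
Lemma primitiveM F f G g : primitive F f -> primitive G g ->
  primitive (fun x => F x * G x) (fun x => f x * G x + F x * g x).
Proof.
move=> Ff Gg; have [fi _] := Ff; have [gi _] := Gg.
have cF := primitive_continuous a0 Ff; have cG := primitive_continuous a0 Gg.
have ki : integrableI a (fun x => f x * G x + F x * g x).
  have fGi := integrableI_mul a0 cG fi; have Fgi := integrableI_mul a0 cF gi.
  apply: eq_integrable (integrableID fGi Fgi) => // x _ /=.
  by rewrite [f x * _]mulrC.
have bi : integrableI a (fun x => `|f x| + `|g x|).
  exact: integrableID (integrableI_norm fi) (integrableI_norm gi).
have Kk := antiderivP ki; have Bb := antiderivP bi.
set K := antideriv a _ in Kk; set B := antideriv a _ in Bb.
apply: (primitive_local Kk Bb) => [t|c ac ca e e0]; first exact: addr_ge0.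
have [d1 d10 oF] := continuousI_osc cF ac ca e0.
have [d2 d20 oG] := continuousI_osc cG ac ca e0.
exists (Num.min d1 d2); first by rewrite lt_min d10.
move=> u v au uv va.
rewrite ltrBlDr -ltrBlDl lt_min => /andP[cu1 cu2].
rewrite -ltrBlDl lt_min => /andP[vc1 vc2].
have Pp := primitiveB (primitiveB Kk (primitiveZ (G v) Ff)) (primitiveZ (F u) Gg).
have := le_primitive Pp (primitiveZ e Bb) au uv va.
rewrite -mulrBr => le; rewrite -normrN.
apply: le_trans (le _) => [|t ut tv].
  by rewrite le_eqVlt; apply/orP; left; apply/eqP; congr `|_|; rewrite /=; ring.
rewrite /= [X in `|X|](_ : _ = f t * (G t - G v) + (F t - F u) * g t);
  last by ring.
rewrite [leRHS]mulrDr (le_trans (ler_normD _ _))// !normrM lerD//.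
  by rewrite mulrC ler_wpM2r// oG//; lra.
by rewrite ler_wpM2r// oF//; lra.
Qed.

(** The chain rule for differentiable functions does not apply, as Q is only
absolutely continuous. The convexity bounds
exp(s) (t - s) <= exp(t) - exp(s) <= exp(t) (t - s) do the work instead. *)
Lemma primitive_exp Q r : primitive Q r ->
  primitive (fun x => expR (Q x)) (fun x => expR (Q x) * r x).
Proof.
move=> Qr; have [ri _] := Qr; have cQ := primitive_continuous a0 Qr.
have cE : continuousI (expR \o Q).
  by apply: continuousI_comp cQ; exact: continuous_expR.
have Kk := antiderivP (integrableI_mul a0 cE ri).
have Bb := antiderivP (integrableI_norm ri).
set K := antideriv a _ in Kk; set B := antideriv a _ in Bb.
apply: (primitive_local Kk Bb) => [t|c ac ca e e0]; first exact: normr_ge0.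
have e20 : 0 < e / 2 by lra.
have [d d0 oE] := continuousI_osc cE ac ca e20.
exists d => // u v au uv va cu vc.
pose E := expR (Q u).
have Pp := primitiveB Kk (primitiveZ E Qr).
have := le_primitive Pp (primitiveZ (e / 2) Bb) au uv va.
rewrite -mulrBr.
set X := (X in `|X| <= _) => leX.
have {}leX : `|X| <= e / 2 * (B v - B u).
  apply: leX => t ut tv /=; rewrite -mulrBl normrM ler_wpM2r// oE//; lra.
have dQ : `|Q v - Q u| <= B v - B u.
  by apply: (le_primitive Qr Bb).
(* Y0 and Y1: the error of the first-order expansion at u lies between 0 and
   the product of the increments of exp Q and Q. *)
have Y0 : 0 <= expR (Q v) - E - E * (Q v - Q u).
  have := expR_ge1Dx (Q v - Q u); rewrite -(ler_pM2l (expR_gt0 (Q u))).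
  by rewrite -expRD [Q u + _]addrC subrK /E; lra.
have Y1 : expR (Q v) - E - E * (Q v - Q u) <= (expR (Q v) - E) * (Q v - Q u).
  have := expR_ge1Dx (Q u - Q v); rewrite -(ler_pM2l (expR_gt0 (Q v))).
  by rewrite -expRD [Q v + _]addrC subrK /E; lra.
have Y2 : (expR (Q v) - E) * (Q v - Q u) <= e / 2 * (B v - B u).
  apply: (le_trans (ler_norm _)); rewrite normrM ler_pM// oE//; lra.
have -> : expR (Q v) - expR (Q u) - (K v - K u) =
   (expR (Q v) - E - E * (Q v - Q u)) - X by rewrite /X /E /=; ring.
apply: (le_trans (ler_normB _ _)); rewrite (ger0_norm Y0); lra.
Qed.

Lemma primitive_derive F : (forall x, derivable F x 1) ->
  continuous (derive1 F) -> primitive F (derive1 F).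
Proof.
move=> dF cF'; split.
  apply: continuousI_integrable => //; apply/continuousIP.
  exact: continuous_subspaceT.
move=> x y ax; rewrite le_eqVlt => /predU1P[<- _|xy ya].
  by rewrite subrr set_itv_ge ?Rintegral_set0// bnd_simp ltxx.
have cFx : continuous F.
  by move=> t; apply: differentiable_continuous; apply/derivable1_diffP.
have := @continuous_FTC2 _ (derive1 F) F _ _ xy (continuous_subspaceT cF').
rewrite /Rintegral.
have -> : (\int[mu]_(x0 in `]x, y[) (derive1 F x0)%:E =
   \int[mu]_(x0 in `[x, y]) (derive1 F x0)%:E)%E.
  apply/esym/integral_itv_bndoo; apply/measurable_EFinP.
  apply: (@measurable_funS _ _ _ _ setT) => //.
  exact: continuous_measurable_fun.
move=> -> //; split => //.
- by apply: cvg_at_right_filter; exact: cFx.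
- by apply: cvg_at_left_filter; exact: cFx.
Qed.

End Rules.

(** * A smooth ramp *)

Section Smooth.
Context {R : realType}.
Implicit Types (f g : R -> R) (n : nat) (x : R).

(** Differentiability of the derivatives of orders 0 to n. The recursion on the
derivative, rather than a bound on the order, is what makes closure under
products and inverses a direct induction. *)
Fixpoint smooth_upto n f : Prop :=
  (forall x, derivable f x 1) /\
  if n is n'.+1 then smooth_upto n' (derive1 f) else True.

Lemma smooth_upto_derivable n f x : smooth_upto n f -> derivable f x 1.
Proof. by case: n => [|n] []. Qed.

Lemma smooth_uptoW n f : smooth_upto n.+1 f -> smooth_upto n f.
Proof. by elim: n f => [f [? _]//|n IH f [df sf']]; split => //; exact: IH. Qed.

Lemma is_derive_derive1 f x : derivable f x 1 -> is_derive x 1 f (derive1 f x).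
Proof. by move=> df; rewrite derive1E; exact: DeriveDef. Qed.

Lemma is_derive_fun f g : (forall x : R, is_derive x 1 f (g x)) -> derive1 f = g.
Proof. by move=> fg; apply/funext => x; rewrite derive1E; have [_ ->] := fg x. Qed.

Lemma smooth_uptoS n f g : (forall x : R, is_derive x 1 f (g x)) ->
  smooth_upto n g -> smooth_upto n.+1 f.
Proof.
by move=> fg gn; split=> [x|]; [have [] := fg x|rewrite (is_derive_fun fg)].
Qed.

Lemma smooth_upto_is_derive n f x :
  smooth_upto n f -> is_derive x 1 f (derive1 f x).
Proof. move=> sf; apply: is_derive_derive1; exact: smooth_upto_derivable sf. Qed.

Lemma smooth_upto0 f g : (forall x : R, is_derive x 1 f (g x)) -> smooth_upto 0 f.
Proof. by move=> fg; split=> // x; have [] := fg x. Qed.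

Lemma smooth_upto_cst n (c : R) : smooth_upto n (cst c).
Proof.
elim: n c => [|n IH] c; first by apply: smooth_upto0 => x; exact: is_derive_cst.
by apply: (@smooth_uptoS _ _ (cst 0)) => // x; exact: is_derive_cst.
Qed.

Lemma smooth_upto_id n : smooth_upto n (id : R -> R).
Proof.
case: n => [|n]; first by apply: smooth_upto0 => x; exact: is_derive_id.
by apply: (@smooth_uptoS _ _ (cst 1)) => //; exact: smooth_upto_cst.
Qed.

Lemma smooth_uptoD n f g : smooth_upto n f -> smooth_upto n g ->
  smooth_upto n (fun x => f x + g x).
Proof.
have D k (u v : R -> R) : smooth_upto k u -> smooth_upto k v -> forall x : R,
    is_derive x 1 (fun y => u y + v y) (derive1 u x + derive1 v x).
  by move=> su sv x; apply: is_deriveD; apply: smooth_upto_is_derive; eassumption.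
elim: n f g => [|n IH] f g sf sg; first exact: smooth_upto0 (D _ _ _ sf sg).
apply: (smooth_uptoS (D _ _ _ sf sg)).
by case: sf sg => _ sf [_ sg]; exact: IH.
Qed.

Lemma smooth_uptoM n f g : smooth_upto n f -> smooth_upto n g ->
  smooth_upto n (fun x => f x * g x).
Proof.
have D k (u v : R -> R) : smooth_upto k u -> smooth_upto k v -> forall x : R,
    is_derive x 1 (fun y => u y * v y) (u x * derive1 v x + v x * derive1 u x).
  by move=> su sv x; apply: is_deriveM; apply: smooth_upto_is_derive; eassumption.
elim: n f g => [|n IH] f g sf sg; first exact: smooth_upto0 (D _ _ _ sf sg).
apply: (smooth_uptoS (D _ _ _ sf sg)).
have [/smooth_uptoW sf0 /smooth_uptoW sg0] := (sf, sg).
by case: sf sg => _ sf [_ sg]; apply: smooth_uptoD; exact: IH.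
Qed.

Lemma smooth_uptoZ n (c : R) f : smooth_upto n f -> smooth_upto n (fun x => c * f x).
Proof. by apply: smooth_uptoM; exact: smooth_upto_cst. Qed.

(** The derivative of 1 / f is a product of f' and two copies of 1 / f, whose
smoothness at the previous order is the induction hypothesis. *)
Lemma smooth_uptoV n f : (forall x, f x != 0) -> smooth_upto n f ->
  smooth_upto n (fun x => (f x)^-1).
Proof.
move=> f0.
have D k : smooth_upto k f -> forall x : R,
    is_derive x 1 (fun y => (f y)^-1) (- 1 * ((f x)^-1 * (f x)^-1 * derive1 f x)).
  move=> sf x; apply: is_derive_eq.
    by apply: is_deriveV => //; exact: smooth_upto_is_derive sf.
  by rewrite /GRing.scale/= expr2 invfM; ring.
elim: n => [|n IH] sf; first exact: smooth_upto0 (D _ sf).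
apply: (smooth_uptoS (D _ sf)); apply: smooth_uptoZ.
have sf0 := smooth_uptoW sf.
by apply: smooth_uptoM; [apply: smooth_uptoM; exact: IH|case: sf].
Qed.

Lemma smooth_upto_affine n f (c d : R) : smooth_upto n f ->
  smooth_upto n (fun x => f (c * x + d)).
Proof.
have D k (u : R -> R) : smooth_upto k u -> forall x : R,
    is_derive x 1 (fun y => u (c * y + d)) (c * derive1 u (c * x + d)).
  move=> su x.
  have H : is_derive x 1 (fun y : R => c * y + d) c.
    have := is_deriveD (is_deriveZ c (is_derive_id x 1)) (is_derive_cst d x 1).
    by rewrite addr0 /GRing.scale/= mulr1.
  have := @is_derive1_comp _ u (fun y => c * y + d) x _ _
    (smooth_upto_is_derive (c * x + d) su) H.
  by rewrite mulrC.
elim: n f => [|n IH] f sf; first exact: smooth_upto0 (D _ _ sf).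
apply: (smooth_uptoS (D _ _ sf)).
by apply: smooth_uptoZ; apply: IH; case: sf.
Qed.

Definition smooth f := forall n, smooth_upto n f.

Lemma smooth_derive1 f : smooth f -> smooth (derive1 f).
Proof. by move=> sf n; have [] := sf n.+1. Qed.

Lemma smooth_derive1n f n x : smooth f -> derivable (derive1n n f) x 1.
Proof.
elim: n f => [|n IH] f sf; first exact: smooth_upto_derivable (sf 0%N).
by rewrite derive1Sn; apply: IH; exact: smooth_derive1.
Qed.

Lemma derivable_continuous f : (forall x, derivable f x 1) -> continuous f.
Proof.
by move=> df x; apply: differentiable_continuous; exact/derivable1_diffP.
Qed.

(** The functions t^(-n) exp(-1/t), extended by 0: up to linear combinations, this
family is closed under differentiation, hence it consists of smooth functions. *)
Definition flat n (t : R) := if 0 < t then t^-1 ^+ n * expR (- t^-1) else 0.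

(** One term of the exponential series. *)
Lemma expr_le_expR n (s : R) : 0 <= s -> s ^+ n <= n`!%:R * expR s.
Proof.
move=> s0; case: n => [|n].
  by rewrite expr0 fact0 mul1r; have := expR_ge1Dx s; lra.
have f0 : 0 < n.+1`!%:R :> R by rewrite ltr0n fact_gt0.
have := expR_ge1Dxn n s0; rewrite -ler_pdivrMl//; lra.
Qed.

(** Quadratic decay at 0 gives the derivative of [flat n] there. *)
Lemma flat_le n t : `|flat n t| <= n.+2`!%:R * t ^+ 2.
Proof.
rewrite /flat; case: ifPn => t0; last first.
  by rewrite normr0 mulr_ge0// exprn_even_ge0.
have s0 : 0 < t^-1 by rewrite invr_gt0.
rewrite ger0_norm ?mulr_ge0 ?exprn_ge0 ?expR_ge0 ?(ltW s0)//.
have := expr_le_expR n.+2 (ltW s0).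
set s := t^-1 => le_s.
have -> : s ^+ n = s ^+ n.+2 * t ^+ 2.
  by rewrite -addn2 exprD -mulrA -exprMn mulVf ?gt_eqF// expr1n mulr1.
rewrite expRN ler_pdivrMr ?expR_gt0// [leRHS]mulrAC.
by rewrite ler_wpM2r// exprn_even_ge0.
Qed.

Lemma is_derive_flat n x :
  is_derive x 1 (flat n) (- n%:R * flat n.+1 x + flat n.+2 x).
Proof.
have [x0|x0|->] := ltgtP x 0.
- rewrite /flat ltNge (ltW x0)/= mulr0 addr0.
  apply: (@near_eq_is_derive _ _ _ (cst 0)).
  near=> t; rewrite ltNge; suff -> : t <= 0 by [].
  by apply/ltW; near: t; exact: lt_nbhsl.
- rewrite /flat x0.
  apply: (@near_eq_is_derive R R R (fun t : R => t^-1 ^+ n * expR (- t^-1))).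
    near=> t; suff -> : 0 < t by [].
    by near: t; exact: lt_nbhsr.
  have xn0 : x != 0 by rewrite gt_eqF.
  have DV : is_derive x 1 (fun t : R => t^-1) (- x ^- 2).
    apply: is_derive_eq; first exact: (@is_deriveV _ id).
    by rewrite /GRing.scale/= mulr1.
  have DX : is_derive x 1 (fun t : R => t^-1 ^+ n) (n%:R * x^-1 ^+ n.-1 * - x ^- 2).
    by have := @is_deriveX _ _ (fun t : R => t^-1) n x 1 _ DV; rewrite exprfctE.
  have DE : is_derive x 1 (fun t => expR (- t^-1)) (expR (- x^-1) * x ^- 2).
    have := @is_derive1_comp _ expR (fun t => - t^-1) x _ _ (is_derive_expR _)
      (is_deriveN DV).
    by rewrite opprK.
  have DM := is_deriveM DX DE; apply: (is_derive_eq DM).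
  rewrite /GRing.scale/= -!exprVn.
  case: n {DX DM} => [|n] /=; first by rewrite !expr0 !mul0r oppr0 !mul0r; ring.
  by rewrite !exprS; ring.
- have -> : - n%:R * flat n.+1 0 + flat n.+2 0 = 0.
    by rewrite /flat ltxx mulr0 addr0.
  have c0 : flat n 0 = 0 by rewrite /flat ltxx.
  suff l0 : (h^-1 *: ((flat n \o shift 0) (h *: 1) - flat n 0)) @[h --> 0^'] -->
      (0 : R).
    apply: DeriveDef; first by apply/cvg_ex; exists 0.
    exact: cvg_lim.
  apply/cvgrPdist_le => e e0.
  have d0 : 0 < n.+2`!%:R^-1 * e by rewrite mulr_gt0// invr_gt0 ltr0n fact_gt0.
  near=> h.
  rewrite sub0r normrN c0 subr0 /= addr0 /GRing.scale/= mulr1.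
  have hn0 : h != 0 by near: h; exact: nbhs_dnbhs_neq.
  rewrite normrM normfV ler_pdivrMl ?normr_gt0//.
  apply: (le_trans (flat_le n h)).
  rewrite -real_normK ?num_real// expr2 mulrA mulrC ler_wpM2l//.
  rewrite -ler_pdivlMl ?ltr0n ?fact_gt0//.
  near: h; apply: dnbhs0_le; exact: d0.
Unshelve. all: by end_near. Qed.

Lemma smooth_flat n : smooth (flat n).
Proof.
move=> m; elim: m n => [|m IH] n; first exact: smooth_upto0 (is_derive_flat n).
apply: (smooth_uptoS (is_derive_flat n)).
by apply: smooth_uptoD; [apply: smooth_uptoZ|]; exact: IH.
Qed.

Lemma flat0_ge0 (t : R) : 0 <= flat 0 t.
Proof. by rewrite /flat; case: ifP => // _; rewrite expr0 mul1r expR_ge0. Qed.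

Lemma flat0_gt0 (t : R) : 0 < t -> 0 < flat 0 t.
Proof. by rewrite /flat => ->; rewrite expr0 mul1r expR_gt0. Qed.

Lemma flat0_eq0 (t : R) : t <= 0 -> flat 0 t = 0.
Proof. by rewrite /flat ltNge => ->. Qed.

(** t sigma(t), where sigma is the usual smooth step from 0 on t <= 0 to 1 on
1 <= t: the ramp is 0 for t <= 0 and the identity for t >= 1. This
explicit formula replaces the double integral of a bump. *)
Definition ramp (t : R) := t * (flat 0 t / (flat 0 t + flat 0 (1 - t))).

Lemma ramp_le0 t : t <= 0 -> ramp t = 0.
Proof. by move=> t0; rewrite /ramp flat0_eq0// mul0r mulr0. Qed.

Lemma ramp_ge1 t : 1 <= t -> ramp t = t.
Proof.
move=> t1; rewrite /ramp (@flat0_eq0 (1 - t)) ?subr_le0// addr0 divff ?mulr1//.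
by rewrite gt_eqF// flat0_gt0//; lra.
Qed.

Lemma smooth_ramp : smooth ramp.
Proof.
move=> n; apply: smooth_uptoM; first exact: smooth_upto_id.
apply: smooth_uptoM; first exact: smooth_flat.
apply: smooth_uptoV => [t|].
  have [t0|t0] := leP t (1/2); rewrite gt_eqF//.
    by rewrite ltr_wpDl ?flat0_ge0// flat0_gt0//; lra.
  by rewrite ltr_wpDr ?flat0_ge0// flat0_gt0//; lra.
apply: smooth_uptoD; first exact: smooth_flat.
have -> : (fun t : R => flat 0 (1 - t)) = (fun t => flat 0 (- 1 * t + 1)).
  by apply/funext => t; congr flat; ring.
exact/smooth_upto_affine/smooth_flat.
Qed.

End Smooth.

(** * The lemma of du Bois-Reymond *)

Section RampDerivative.
Context {R : realType}.
Implicit Types x t : R.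

Lemma derivable_ramp t : derivable (ramp : R -> R) t 1.
Proof. exact: smooth_upto_derivable (smooth_ramp 0). Qed.

Lemma continuous_ramp' : continuous (derive1 (ramp : R -> R)).
Proof.
apply: derivable_continuous => x.
exact: smooth_upto_derivable (smooth_derive1 smooth_ramp 0).
Qed.

Lemma ramp'_lt0 t : t < 0 -> derive1 ramp t = 0.
Proof.
move=> t0; have [_ dt] : is_derive t 1 (ramp : R -> R) 0.
  apply: (@near_eq_is_derive _ _ _ (cst 0)).
  near=> u; rewrite ramp_le0//; apply: ltW; near: u; exact: lt_nbhsl.
by rewrite derive1E.
Unshelve. all: by end_near. Qed.

Lemma ramp'_gt1 t : 1 < t -> derive1 ramp t = 1.
Proof.
move=> t0; have [_ dt] : is_derive t 1 (ramp : R -> R) 1.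
  apply: (@near_eq_is_derive _ _ _ id).
  near=> u; rewrite ramp_ge1//; apply: ltW; near: u; exact: lt_nbhsr.
by rewrite derive1E.
Unshelve. all: by end_near. Qed.

Lemma ramp'_le0 t : t <= 0 -> derive1 ramp t = 0.
Proof.
rewrite le_eqVlt => /predU1P[->|]; last exact: ramp'_lt0.
(* At t = 0, use the continuity of the derivative, which is 0 on t < 0. *)
apply/eqP; apply: contraT => r0.
have e0 : 0 < `|derive1 (ramp : R -> R) 0| by rewrite normr_gt0.
have /cvgrPdist_lt/(_ _ e0)[d /= d0 dr] := @continuous_ramp' 0.
have /dr : ball 0 d (- (d / 2)).
  rewrite -ball_normE/= opprK add0r gtr0_norm ?divr_gt0//.
  by rewrite ltr_pdivrMr// mulr_natr mulr2n ltrDl.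
by rewrite (ramp'_lt0 (t := - (d / 2))) ?subr0 ?ltxx// oppr_lt0 divr_gt0.
Qed.

Lemma ramp'_bounded : exists2 M, 0 < M & forall t, `|derive1 (ramp : R -> R) t| <= M.
Proof.
have [M M0 MP] : exists2 M, 0 < M & forall x, - 1 <= x -> x <= 1 ->
    `|derive1 (ramp : R -> R) x| <= M.
  apply: continuousI_bounded => //; apply/continuousIP.
  exact/continuous_subspaceT/continuous_ramp'.
exists (M + 1); first lra.
move=> t; have [t0|t0] := leP t 0; first by rewrite ramp'_le0// normr0; lra.
have [t1|t1] := leP t 1; last by rewrite ramp'_gt1// normr1; lra.
by have := MP t ltac:(lra) t1; lra.
Qed.

(** The rescaling keeps the slope 1 on the right and shrinks the transition
interval to length 1 / (n + 1); the derivatives tend to the indicator of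
]x, +oo[. *)
Definition scaled_ramp (n : nat) (x t : R) := n.+1%:R^-1 * ramp (n.+1%:R * (t - x)).

Lemma smooth_scaled_ramp n x : smooth (scaled_ramp n x).
Proof.
move=> m; apply: smooth_uptoZ.
have -> : (fun t => ramp (n.+1%:R * (t - x))) =
    (fun t => ramp (n.+1%:R * t + (- n.+1%:R * x))).
  by apply/funext => t; congr ramp; ring.
exact/smooth_upto_affine/smooth_ramp.
Qed.

Lemma is_derive_scaled_ramp n x t :
  is_derive t 1 (scaled_ramp n x) (derive1 ramp (n.+1%:R * (t - x))).
Proof.
have H : is_derive t 1 (fun t => n.+1%:R * (t - x)) n.+1%:R.
  have := is_deriveZ n.+1%:R (is_deriveB (is_derive_id t 1) (is_derive_cst x t 1)).
  by rewrite subr0 /GRing.scale/= mulr1.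
have H1 := is_derive_derive1 (@derivable_ramp (n.+1%:R * (t - x))).
have H2 := @is_derive1_comp _ ramp (fun t => n.+1%:R * (t - x)) t _ _ H1 H.
have := is_deriveZ n.+1%:R^-1 H2.
by rewrite /GRing.scale/= mulrCA mulVf ?mulr1// pnatr_eq0.
Qed.

Lemma scaled_ramp_le n x t : t <= x -> scaled_ramp n x t = 0.
Proof.
by move=> tx; rewrite /scaled_ramp ramp_le0 ?mulr0// mulr_ge0_le0// subr_le0.
Qed.

Lemma scaled_ramp_ge n x t : x + n.+1%:R^-1 <= t -> scaled_ramp n x t = t - x.
Proof.
move=> xt; rewrite /scaled_ramp ramp_ge1.
  by rewrite mulrA mulVf ?mul1r// pnatr_eq0.
by rewrite -ler_pdivrMl// mulr1 lerBrDl.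
Qed.

Lemma cvg_ramp' (x : R) :
  (derive1 ramp (n.+1%:R * x) : R) @[n --> \oo] --> ((0 < x)%R%:R : R).
Proof.
have [x0|x0] := ltP 0 x; last first.
  rewrite (_ : (fun n => _) = cst 0); first exact: cvg_cst.
  by apply/funext => n; rewrite ramp'_le0// mulr_ge0_le0.
apply: (@cvg_trans _ ((fun=> 1 : R) @ \oo)); last exact: cvg_cst.
apply: near_eq_cvg; near=> n; rewrite ramp'_gt1//.
rewrite -ltr_pdivrMr// div1r.
have : x^-1 < n%:R by near: n; exact: nbhs_infty_gtr.
by move=> /lt_le_trans; apply; rewrite ler_nat.
Unshelve. all: by end_near. Qed.

End RampDerivative.

Section DuBoisReymond.
Context {R : realType}.
Notation mu := (@lebesgue_measure R).
Variable a : R.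
Hypothesis a0 : 0 < a.
Implicit Types (f g h F G H : R -> R) (x y : R).

(** A smoothed trapezoid that goes up after x and down after y. To the right of
all transitions the four ramps are t - x, t - x - s, t - y and t - y - s, whose
alternating sum vanishes. *)
Lemma ramp_test n x y (s : R) : - a < x -> x < y -> 0 < s ->
  y + s + n.+1%:R^-1 < a ->
  test_function a (fun t => scaled_ramp n x t + - 1 * scaled_ramp n (x + s) t +
     (- 1 * scaled_ramp n y t + scaled_ramp n (y + s) t)).
Proof.
move=> ax xy s0 ya.
have n0 : 0 < n.+1%:R^-1 :> R by rewrite invr_gt0.
have sge (z t : R) : z + n.+1%:R^-1 <= t -> scaled_ramp n z t = t - z.
  exact: scaled_ramp_ge.
move: (n.+1%:R^-1) ya n0 sge => e ya n0 sge.
split.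
  move=> k t; apply: smooth_derive1n => m.
  have sr z := @smooth_scaled_ramp R n z m.
  by apply: smooth_uptoD; apply: smooth_uptoD; [|apply: smooth_uptoZ..|];
    exact: sr.
exists `[x, y + s + e]%classic; split; first exact: segment_compact.
  move=> t /=; rewrite !in_itv/= => /andP[? ?]; apply/andP; lra.
move=> t /=; rewrite in_itv/= => /negP; rewrite negb_and -!ltNge => /orP[tx|yt].
  by rewrite !scaled_ramp_le ?mulr0 ?addr0//; lra.
by rewrite !sge; lra.
Qed.

Lemma scaled_ramp_integrable h n x : integrableI a h ->
  integrableI a (fun t => h t * derive1 ramp (n.+1%:R * (t - x))).
Proof.
move=> hi.
have -> : (fun t => h t * derive1 ramp (n.+1%:R * (t - x))) =
  (fun t => derive1 ramp (n.+1%:R * (t - x)) * h t).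
  by apply/funext => t; rewrite mulrC.
apply: integrableI_mul => //; first exact: ltW.
apply/continuousIP/continuous_subspaceT => t.
apply: (@continuous_comp _ _ _ (fun t => n.+1%:R * (t - x)) (derive1 ramp)).
  by apply: cvgM; [exact: cvg_cst|apply: cvgB; [exact: cvg_id|exact: cvg_cst]].
exact: continuous_ramp'.
Qed.

(** Dominated convergence. *)
Lemma cvg_integral_ramp F h x : primitive a F h -> - a <= x -> x <= a ->
  (\int[mu]_(t in `]- a, a[) (h t * derive1 ramp (n.+1%:R * (t - x))))
    @[n --> \oo] --> F a - F x.
Proof.
move=> Fh ax xa; have [hi Fhx] := Fh.
have [M M0 bM] := @ramp'_bounded R.
have eqI : F a - F x = \int[mu]_(t in `]- a, a[) (h t * (0 < t - x)%R%:R).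
  rewrite Fhx//.
  have -> : `]x, a[%classic = `]- a, a[%classic `&` `]x, a[%classic :> set R.
    apply/seteqP; split => t /=; rewrite !in_itv/=; last by case.
    by move=> /andP[xt ta]; rewrite xt ta (le_lt_trans ax).
  rewrite Rintegral_mkcondr; apply: eq_Rintegral => t.
  rewrite inE/= in_itv/= => /andP[_ ta].
  rewrite patchE subr_gt0; case: ifPn; rewrite ?inE ?notin_setE/= in_itv/= ta andbT.
    by move=> ->; rewrite mulr1.
  by move=> /negP/negbTE ->; rewrite mulr0.
rewrite eqI.
have := @dominated_convergence _ _ R mu `]- a, a[ (measurable_itv _)
  (fun n t => (h t * derive1 ramp (n.+1%:R * (t - x)))%:E)
  (fun t => (h t * (0 < t - x)%R%:R)%:E) (fun t => (M * `|h t|)%:E).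
case.
- by move=> n; exact: measurable_int (scaled_ramp_integrable n x hi).
- apply: emeasurable_fun_cvg.
    by move=> n; exact: measurable_int (scaled_ramp_integrable n x hi).
  move=> t _ /=; apply: cvg_EFin; first by near=> n.
  by apply: cvgM; [exact: cvg_cst|exact: cvg_ramp'].
- apply: aeW => t _; apply: cvg_EFin; first by near=> n.
  by apply: cvgM; [exact: cvg_cst|exact: cvg_ramp'].
- by have := integrableIZ M (integrableI_norm hi).
- apply: aeW => t n _; rewrite /= lee_fin normrM mulrC ler_wpM2r//.
- move=> Hi _ H; apply: fine_cvg.
  by rewrite /Rintegral fineK//; exact: integrable_fin_num Hi.
Unshelve. all: by end_near. Qed.


(** Signs are written as multiplications by -1 to match the shape of the test
function in [ramp_test]. *)
Lemma integral_ramp_combination f g h k : integrableI a f -> integrableI a g ->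
  integrableI a h -> integrableI a k ->
  \int[mu]_(t in `]- a, a[) (f t + - 1 * g t + (- 1 * h t + k t)) =
  \int[mu]_(t in `]- a, a[) f t + - 1 * \int[mu]_(t in `]- a, a[) g t +
  (- 1 * \int[mu]_(t in `]- a, a[) h t + \int[mu]_(t in `]- a, a[) k t).
Proof.
move=> fi gi hi ki.
have gi' := integrableIZ (- 1) gi; have hi' := integrableIZ (- 1) hi.
rewrite (integralID (integrableID fi gi') (integrableID hi' ki)).
by rewrite (integralID fi gi') (integralID hi' ki) !integralIZ.
Qed.

(** In the limit, testing h against smoothed trapezoids compares its integrals over
]x, x + s[ and ]y, y + s[. *)
Lemma equal_increments F h x y (s : R) : primitive a F h ->
  (forall p, test_function a p ->
     \int[mu]_(t in `]- a, a[) (h t * derive1 p t) = 0) ->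
  - a < x -> x < y -> 0 < s -> y + s < a ->
  F (x + s) - F x = F (y + s) - F y.
Proof.
move=> Fh hp ax xy s0 ya; have [hi _] := Fh.
pose J n z := \int[mu]_(t in `]- a, a[) (h t * derive1 ramp (n.+1%:R * (t - z))).
have cJ z : - a <= z -> z <= a -> J n z @[n --> \oo] --> F a - F z.
  by move=> az za; exact: cvg_integral_ramp.
pose S n := J n x + - 1 * J n (x + s) + (- 1 * J n y + J n (y + s)).
have S0 : \forall n \near \oo, S n = 0.
  near=> n.
  have nya : y + s + n.+1%:R^-1 < a.
    rewrite -ltrBrDl invf_plt ?posrE ?subr_gt0//.
    have : (a - (y + s))^-1 < n%:R by near: n; exact: nbhs_infty_gtr.
    by move=> /lt_le_trans; apply; rewrite ler_nat.
  have i z := scaled_ramp_integrable n z hi.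
  rewrite /S /J -integral_ramp_combination//.
  rewrite -[RHS](hp _ (ramp_test ax xy s0 nya)).
  have dE : derive1 (fun t => scaled_ramp n x t + - 1 * scaled_ramp n (x + s) t +
     (- 1 * scaled_ramp n y t + scaled_ramp n (y + s) t)) =
     (fun t => derive1 ramp (n.+1%:R * (t - x)) +
       - 1 * derive1 ramp (n.+1%:R * (t - (x + s))) +
       (- 1 * derive1 ramp (n.+1%:R * (t - y)) +
        derive1 ramp (n.+1%:R * (t - (y + s))))).
    apply: is_derive_fun => t.
    have D z := is_derive_scaled_ramp n z t.
    exact: (is_deriveD (is_deriveD (D x) (is_deriveZ (- 1) (D _)))
                       (is_deriveD (is_deriveZ (- 1) (D y)) (D _))).
  rewrite dE; apply: eq_Rintegral => t _; move: (derive1 _) => r.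
  by rewrite !mulrDr !(mulrCA (h t)).
have cS : S n @[n --> \oo] -->
    F a - F x + - 1 * (F a - F (x + s)) + (- 1 * (F a - F y) + (F a - F (y + s))).
  have c1 : (- 1 : R) @[_ --> \oo] --> (- 1 : R) by exact: cvg_cst.
  apply: cvgD; apply: cvgD.
  - by apply: cJ; lra.
  - by apply: cvgM => //; apply: cJ; lra.
  - by apply: cvgM => //; apply: cJ; lra.
  - by apply: cJ; lra.
have cS0 : S n @[n --> \oo] --> (0 : R).
  apply: (@cvg_trans _ ((fun=> 0 : R) @ \oo)); last exact: cvg_cst.
  by apply: near_eq_cvg; apply: filterS S0 => n ->.
have := @cvg_unique _ (@Rhausdorff R) _ _ _ _ cS cS0.
by move=> /(_ _); lra.
Unshelve. all: by end_near. Qed.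

(** Lebesgue's differentiation theorem. *)
Lemma ae_derive_antideriv h : integrableI a h ->
  {ae mu, forall x, x \in `]- a, a[ ->
     is_derive x 1 (antideriv a h) (h x)}.
Proof.
move=> hi.
have hR := @integrable_restrictI _ _ h setT measurableT hi.
have := @FTC1 _ (h \_ `]- a, a[) (BLeft (- a)).
case.
- by move=> y; exact: integrable_restrictI.
- exact: (integrable_locally (measurable_itv `]- a, a[) hi).
- move=> /= A /=; case=> mA A0 sA; exists A; split => // x /= nx.
  apply: sA => /= H; apply: nx; rewrite in_itv/= => /andP[ax xa].
  have lt_ax : ((- a)%:E < x%:E)%E by rewrite lte_fin.
  have [] := H lt_ax.
  have -> : (h \_ `]- a, a[) x = h x by rewrite patchE mem_set//= in_itv/= ax xa.
  move=> d1 d2.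
  by rewrite -d2; exact: is_derive_derive1.
Qed.

Lemma is_derive_right_quotient F x (l : R) : is_derive x 1 F l ->
  s^-1 * (F (x + s) - F x) @[s --> 0^'+] --> l.
Proof.
move=> [/cvg_ex[l' Hl'] dl].
have := Hl'; rewrite /derive in dl.
have /(_ (@Rhausdorff R)) dl' := cvg_lim _ Hl'.
rewrite -dl dl' => /cvg_dnbhs_at_right.
apply: cvg_trans; apply: near_eq_cvg; near=> s.
by rewrite /= /GRing.scale/= mulr1 [s + x]addrC.
Unshelve. all: by end_near. Qed.

(** At two points where a primitive F of h has derivative h, dividing the equality
of increments by s gives h x = h y as s tends to 0. *)
Lemma du_Bois_Reymond h : integrableI a h ->
  (forall p, test_function a p ->
     \int[mu]_(t in `]- a, a[) (h t * derive1 p t) = 0) ->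
  exists c, {ae mu, forall x, x \in `]- a, a[ -> h x = c}.
Proof.
move=> hi hp; pose F := antideriv a h.
have eqh x y : - a < x -> x < y -> y < a -> is_derive x 1 F (h x) ->
    is_derive y 1 F (h y) -> h x = h y.
  move=> ax xy ya /is_derive_right_quotient dx /is_derive_right_quotient dy.
  suff dx' : s^-1 * (F (y + s) - F y) @[s --> 0^'+] --> h x.
    exact: cvg_unique dx' dy.
  apply: cvg_trans dx; apply: near_eq_cvg; near=> s; congr (_ * _).
  apply: equal_increments => //; [exact: antiderivP|exact: hp|].
  by rewrite addrC -ltrBrDr; near: s; apply: nbhs_right_lt; rewrite subr_gt0.
have aeD := ae_derive_antideriv hi.
have [[x0 [Ix0 Dx0]]|nex] := pselect (exists x0 : R, (x0 \in `]- a, a[) /\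
    is_derive x0 1 F (h x0)).
  exists (h x0); apply: ae_impl aeD => x H Ix; have Dx := H Ix.
  move: Ix Ix0; rewrite !in_itv/= => /andP[ax xa] /andP[ax0 xa0].
  by have [xx|xx|->//] := ltgtP x x0; [|apply/esym]; apply: eqh.
exists 0; apply: ae_impl aeD => x H Ix.
by exfalso; apply: nex; exists x; split; [exact: Ix|exact: H].
Unshelve. all: by end_near. Qed.

End DuBoisReymond.

(** * Integration by parts against test functions *)

Section ByParts.
Context {R : realType}.
Notation mu := (@lebesgue_measure R).
Variable a : R.
Hypothesis a0 : 0 < a.
Implicit Types (f g h F G H p : R -> R) (x y : R).

Lemma opp_le_pos : - a <= a. Proof. by move: a0; lra. Qed.

Lemma test_continuous n p : test_function a p -> continuous (derive1n n p).
Proof. by case=> dp _; apply: derivable_continuous. Qed.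

Lemma test_end p x : test_function a p -> x <= - a \/ a <= x -> p x = 0.
Proof.
move=> [_ [K [_ KI p0]]] xa; apply: p0 => /KI /=; rewrite in_itv/= => /andP[].
by case: xa; lra.
Qed.

Lemma test_derive1 p : test_function a p -> test_function a (derive1 p).
Proof.
move=> [dp [K [cK KI p0]]]; split=> [n x|].
  by have := dp n.+1 x; rewrite derive1Sn.
exists K; split=> // x nKx.
suff : is_derive x 1 p 0 by case=> _ dx; rewrite derive1E.
apply: (@near_eq_is_derive _ _ _ (cst 0)).
have oK : open (~` K) by apply/closed_openC/(compact_closed (@Rhausdorff R)).
near=> t; rewrite p0//; suff : (~` K) t by [].
near: t; apply: (open_nbhs_nbhs (conj oK _)); exact: nKx.
Unshelve. all: by end_near. Qed.

Lemma integrableI_test p f : continuous p -> integrableI a f ->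
  integrableI a (fun x => f x * p x).
Proof.
move=> cp fi; have -> : (fun x => f x * p x) = (fun x => p x * f x).
  by apply/funext => x; rewrite mulrC.
apply: integrableI_mul => //; first exact: ltW.
by apply/continuousIP; exact: continuous_subspaceT.
Qed.

(** The product F p vanishes at both ends, and it is a primitive of g p + F p'. *)
Lemma primitive_by_parts F g p : primitive a F g -> test_function a p ->
  \int[mu]_(x in `]- a, a[) (F x * derive1 p x) =
  - \int[mu]_(x in `]- a, a[) (g x * p x).
Proof.
move=> Fg tp; have [gi _] := Fg.
have dp x : derivable p x 1 by case: tp => /(_ 0%N x).
have pp : primitive a p (derive1 p).
  exact: (primitive_derive (ltW a0) dp (test_continuous (n := 1) tp)).
have [_ /(_ (- a) a)] := primitiveM (ltW a0) Fg pp.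
have pa : p a = 0 by apply: (test_end tp); right.
have pNa : p (- a) = 0 by apply: (test_end tp); left.
rewrite pa pNa !mulr0 subrr => H.
have := H (lexx _) opp_le_pos (lexx _); rewrite integralID; last 2 first.
- by apply: integrableI_test => //; exact: (test_continuous (n := 0) tp).
- apply: integrableI_test; first exact: (test_continuous (n := 1) tp).
  exact/(continuousI_integrable (ltW a0))/(primitive_continuous (ltW a0) Fg).
by move=> E0; lra.
Qed.

(** A primitive G of g has weak derivative g, so that u - G has weak derivative 0
and is almost everywhere constant. *)
Lemma weak_derivative_primitive u g : integrableI a u -> integrableI a g ->
  (forall p, test_function a p ->
    \int[mu]_(x in `]- a, a[) (u x * derive1 p x) =
    - \int[mu]_(x in `]- a, a[) (g x * p x)) ->
  exists2 F, primitive a F g & {ae mu, forall x, x \in `]- a, a[ -> u x = F x}.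
Proof.
move=> ui gi ug; have Gg := antiderivP gi; set G := antideriv a g in Gg.
have Gi : integrableI a G.
  exact/(continuousI_integrable (ltW a0))/(primitive_continuous (ltW a0) Gg).
have NGi := integrableIZ (- 1) Gi.
have [||c hc] := @du_Bois_Reymond R a a0 (fun x => u x + - 1 * G x).
- exact: integrableID.
- move=> p tp; have cp' := test_continuous (n := 1) tp.
  have := ug p tp; rewrite -(primitive_by_parts Gg tp) => uG.
  have -> : (fun t => (u t + - 1 * G t) * derive1 p t) =
      (fun t => u t * derive1 p t + - 1 * (G t * derive1 p t)).
    by apply/funext => t; rewrite mulrDl mulrA.
  rewrite integralID ?integralIZ ?uG ?mulN1r ?subrr//;
    try apply: integrableIZ; exact: integrableI_test.
exists (fun x => G x + c).
  apply: (eq_primitive _ _ (primitiveD Gg (primitive_cst a c))) => x _ _ //=.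
  by rewrite addr0.
by apply: ae_impl hc => x H Ix; have := H Ix; lra.
Qed.

Lemma ae_eq_Rintegral f g : measurable_fun `]- a, a[ f ->
  measurable_fun `]- a, a[ g ->
  {ae mu, forall x, x \in `]- a, a[ -> f x = g x} ->
  \int[mu]_(x in `]- a, a[) f x = \int[mu]_(x in `]- a, a[) g x.
Proof.
move=> mf mg fg; congr fine; apply: ae_eq_integral => //.
- exact/measurable_EFinP.
- exact/measurable_EFinP.
- by apply: ae_impl fg => x H /= Ix; rewrite H.
Qed.

Lemma ae_eq_primitive F f g : primitive a F f -> integrableI a g ->
  {ae mu, forall x, x \in `]- a, a[ -> f x = g x} -> primitive a F g.
Proof.
move=> [fi Ff] gi fg; split=> // x y ax xy ya; rewrite Ff//.
have mi h : integrableI a h -> measurable_fun `]x, y[ (EFin \o h).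
  by move=> hi; exact: measurable_int (integrableI_sub hi ax ya).
congr fine; apply: ae_eq_integral => //; [exact: (mi f)|exact: (mi g)|].
apply: ae_impl fg => t H /=; rewrite in_itv/= => /andP[xt ty]; rewrite H//.
by rewrite in_itv/= (le_lt_trans ax)// (lt_le_trans ty).
Qed.

End ByParts.

(** * Complex-valued primitives and weak solutions *)

Section ComplexParts.
Context {R : realType}.
Implicit Types (z w : R[i]) (x r : R).
Local Notation Re := (@complex.Re R).
Local Notation Im := (@complex.Im R).

Lemma complexP z w : Re z = Re w -> Im z = Im w -> z = w.
Proof. by case: z => a b; case: w => c d /= -> ->. Qed.

Lemma ReD z w : Re (z + w) = Re z + Re w. Proof. by case: z; case: w. Qed.
Lemma ImD z w : Im (z + w) = Im z + Im w. Proof. by case: z; case: w. Qed.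
Lemma ReN z : Re (- z) = - Re z. Proof. by case: z. Qed.
Lemma ImN z : Im (- z) = - Im z. Proof. by case: z. Qed.
Lemma ReM z w : Re (z * w) = Re z * Re w - Im z * Im w.
Proof. by case: z; case: w. Qed.
Lemma ImM z w : Im (z * w) = Re z * Im w + Im z * Re w.
Proof. by case: z; case: w. Qed.
Lemma ReMr z r : Re (z * r%:C%C) = Re z * r.
Proof. by rewrite ReM /= mulr0 subr0. Qed.
Lemma ImMr z r : Im (z * r%:C%C) = Im z * r.
Proof. by rewrite ImM /= mulr0 add0r. Qed.

(** The l^1 norm is real-valued, subadditive and submultiplicative, and its
integrability follows from that of the two parts; this makes it more convenient
than the modulus, which takes values in R[i]. *)
Definition norm1 z : R := `|Re z| + `|Im z|.

Lemma norm1_ge0 z : 0 <= norm1 z. Proof. by rewrite addr_ge0. Qed.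

Lemma norm1_eq0 z : norm1 z <= 0 -> z = 0.
Proof.
move=> z0; have := normr_ge0 (Re z); have := normr_ge0 (Im z).
move: z0; rewrite /norm1 => z0 i0 r0.
by apply: complexP => /=; apply/eqP; rewrite -normr_le0; lra.
Qed.

Lemma norm10 : norm1 0 = 0. Proof. by rewrite /norm1 /= normr0 addr0. Qed.

Lemma norm11 : norm1 1 = 1. Proof. by rewrite /norm1 /= normr1 normr0 addr0. Qed.

Lemma norm1D z w : norm1 (z + w) <= norm1 z + norm1 w.
Proof. by rewrite /norm1 ReD ImD addrACA lerD// ler_normD. Qed.

Lemma norm1N z : norm1 (- z) = norm1 z.
Proof. by rewrite /norm1 ReN ImN !normrN. Qed.

Lemma norm1B z w : norm1 (z - w) <= norm1 z + norm1 w.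
Proof. by rewrite -[norm1 w]norm1N norm1D. Qed.

Lemma norm1M z w : norm1 (z * w) <= norm1 z * norm1 w.
Proof.
rewrite /norm1 ReM ImM.
have := ler_normB (Re z * Re w) (Im z * Im w).
have := ler_normD (Re z * Im w) (Im z * Re w).
rewrite !normrM; lra.
Qed.

Lemma norm1X z n : norm1 (z ^+ n) <= norm1 z ^+ n.
Proof.
elim: n => [|n IH]; first by rewrite !expr0 norm11.
rewrite !exprS; apply: (le_trans (norm1M _ _)).
by rewrite ler_wpM2l// norm1_ge0.
Qed.

Lemma norm1Mr z r : norm1 (z * r%:C%C) = norm1 z * `|r|.
Proof. by rewrite /norm1 ReMr ImMr !normrM mulrDl. Qed.

Lemma normc_le_norm1 z : `|z| <= (norm1 z)%:C%C.
Proof.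
rewrite normc_def lecR -[leRHS]ger0_norm ?norm1_ge0// -sqrtr_sqr ler_wsqrtr//.
rewrite /norm1 sqrrD !real_normK ?num_real//.
have : 0 <= `|Re z| * `|Im z| by rewrite mulr_ge0.
by rewrite mulr2n; lra.
Qed.

(** The complex modulus is compared to a real number, so that bounds coming from
the topology of R[i] can be used with real epsilons. *)
Lemma norm1_le_normc z r : `|z| <= r%:C%C -> norm1 z <= r + r.
Proof.
move=> zr; have rr : `|Re z| <= r.
  by rewrite -lecR (le_trans (normc_ge_Re z)).
have ri : `|Im z| <= r.
  rewrite -lecR -[Im z]opprK normrN -ReiNIm.
  apply: (le_trans (normc_ge_Re _)); rewrite normrM.
  suff -> : `|'i%C| = 1 :> R[i] by rewrite mulr1.
  by rewrite normc_def /= expr0n/= expr1n add0r sqrtr1.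
exact: lerD.
Qed.

End ComplexParts.

Section ComplexPrimitives.
Context {R : realType}.
Notation mu := (@lebesgue_measure R).
Variable a : R.
Hypothesis a0 : 0 < a.
Local Notation Re := (@complex.Re R).
Local Notation Im := (@complex.Im R).
Implicit Types (f g h F G H u v : R -> R[i]) (p : R -> R).

Definition cprimitive F f : Prop :=
  primitive a (fun x => Re (F x)) (fun x => Re (f x)) /\
  primitive a (fun x => Im (F x)) (fun x => Im (f x)).

Definition continuousC F : Prop :=
  continuousI a (fun x => Re (F x)) /\ continuousI a (fun x => Im (F x)).

Lemma cprimitive_continuous F f : cprimitive F f -> continuousC F.
Proof. move=> [rF iF]; split.
  exact: primitive_continuous (ltW a0) rF.
exact: primitive_continuous (ltW a0) iF. Qed.

Lemma cprimitive_integrable F f : cprimitive F f -> integrableC a f.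
Proof. by move=> [[rF _] [iF _]]; split. Qed.

Lemma integrableC_ext f g : (forall x, - a < x -> x < a -> f x = g x) ->
  integrableC a f -> integrableC a g.
Proof.
move=> fg [rf im]; split; [move: rf|move: im]; apply: eq_integrable => // x;
  by rewrite inE/= in_itv/= => /andP[ax xa] /=; rewrite fg.
Qed.

Lemma eq_cprimitive F F' f f' :
  (forall x, - a <= x -> x <= a -> F x = F' x) ->
  (forall x, - a < x -> x < a -> f x = f' x) ->
  cprimitive F f -> cprimitive F' f'.
Proof.
by move=> FF ff [rF iF]; split; [move: rF|move: iF]; apply: eq_primitive => x *;
  rewrite ?FF ?ff.
Qed.

Lemma cprimitiveD F f G g : cprimitive F f -> cprimitive G g ->
  cprimitive (fun x => F x + G x) (fun x => f x + g x).
Proof.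
move=> [rF iF] [rG iG]; split.
  by apply: (eq_primitive _ _ (primitiveD rF rG)) => x _ _ /=; rewrite ReD.
by apply: (eq_primitive _ _ (primitiveD iF iG)) => x _ _ /=; rewrite ImD.
Qed.

Lemma cprimitiveZ (c : R[i]) F f : cprimitive F f ->
  cprimitive (fun x => c * F x) (fun x => c * f x).
Proof.
move=> [rF iF]; split.
  apply: (eq_primitive _ _
    (primitiveB (primitiveZ (Re c) rF) (primitiveZ (Im c) iF)));
  by move=> x _ _ /=; rewrite ReM.
apply: (eq_primitive _ _
  (primitiveD (primitiveZ (Re c) iF) (primitiveZ (Im c) rF)));
by move=> x _ _ /=; rewrite ImM.
Qed.

Lemma cprimitive_cst (c : R[i]) : cprimitive (cst c) (cst 0).
Proof. by split; exact: primitive_cst. Qed.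

Lemma integrableCD f g : integrableC a f -> integrableC a g ->
  integrableC a (fun x => f x + g x).
Proof.
move=> [rf im] [rg ig]; split.
  by apply: eq_integrable (integrableID rf rg) => // x _ /=; rewrite ReD.
by apply: eq_integrable (integrableID im ig) => // x _ /=; rewrite ImD.
Qed.

Lemma integrableC_continuousM F f : continuousC F -> integrableC a f ->
  integrableC a (fun x => f x * F x).
Proof.
move=> [rF iF] [rf im].
have M (P p : R -> R) : continuousI a P -> integrableI a p ->
    integrableI a (fun x => P x * p x).
  by move=> cP ip; apply: integrableI_mul => //; exact: ltW.
split.
  have := integrableID (M _ _ rF rf) (integrableIZ (- 1) (M _ _ iF im)).
  by apply: eq_integrable => // x _ /=; rewrite ReM mulN1r mulrC [Im _ * _]mulrC.
have := integrableID (M _ _ iF rf) (M _ _ rF im).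
by apply: eq_integrable => // x _ /=; rewrite ImM mulrC [Im _ * _]mulrC.
Qed.

Lemma continuousC_integrable F : continuousC F -> integrableC a F.
Proof. by move=> [rF iF]; split; apply: continuousI_integrable => //; exact: ltW. Qed.

Lemma cprimitive_exists f : integrableC a f -> exists F, cprimitive F f.
Proof.
move=> [rf im]; exists (fun x => Complex (antideriv a (fun x => Re (f x)) x)
  (antideriv a (fun x => Im (f x)) x)).
by split; exact: antiderivP.
Qed.

Lemma cprimitive_weak_derivative F g : cprimitive F g -> weak_derivative a F g.
Proof.
move=> [rF iF] p tp; apply: complexP; rewrite ?ReN ?ImN /=.
  apply: etrans (etrans (primitive_by_parts a0 rF tp) _).
    by apply: eq_Rintegral => x _; rewrite ReMr.
  by congr (- _); apply: eq_Rintegral => x _; rewrite ReMr.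
apply: etrans (etrans (primitive_by_parts a0 iF tp) _).
  by apply: eq_Rintegral => x _; rewrite ImMr.
by congr (- _); apply: eq_Rintegral => x _; rewrite ImMr.
Qed.

Lemma weak_derivative_cprimitive u g : integrableC a u -> integrableC a g ->
  weak_derivative a u g ->
  exists2 F, cprimitive F g & {ae mu, forall x, x \in `]- a, a[ -> u x = F x}.
Proof.
move=> [ru iu] [rg ig] ug.
have [|Fr rF rae] := weak_derivative_primitive a0 ru rg.
  move=> p /ug /(congr1 Re); rewrite ReN /= => H; apply: etrans (etrans H _).
    by apply: eq_Rintegral => x _; rewrite ReMr.
  by congr (- _); apply: eq_Rintegral => x _; rewrite ReMr.
have [|Fi iF iae] := weak_derivative_primitive a0 iu ig.
  move=> p /ug /(congr1 Im); rewrite ImN /= => H; apply: etrans (etrans H _).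
    by apply: eq_Rintegral => x _; rewrite ImMr.
  by congr (- _); apply: eq_Rintegral => x _; rewrite ImMr.
exists (fun x => Complex (Fr x) (Fi x)); first by split.
apply: ae_impl (ae_and rae iae) => x [Hr Hi] Ix.
by apply: complexP; [exact: Hr|exact: Hi].
Qed.

Lemma integralCD f g : integrableC a f -> integrableC a g ->
  integralC a (fun x => f x + g x) = integralC a f + integralC a g.
Proof.
move=> [rf im] [rg ig]; apply: complexP; rewrite ?ReD ?ImD /= -integralID//;
  by apply: eq_Rintegral => x _; rewrite ?ReD ?ImD.
Qed.

Lemma integrableC_test p f : continuous p -> integrableC a f ->
  integrableC a (fun x => f x * (p x)%:C%C).
Proof.
move=> cp; apply: integrableC_continuousM; split => /=.
  by apply/continuousIP; exact: continuous_subspaceT.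
exact: continuousI_cst.
Qed.

Lemma eq_integralC f g : (forall x, - a < x -> x < a -> f x = g x) ->
  integralC a f = integralC a g.
Proof.
by move=> fg; apply: complexP => /=; apply: eq_Rintegral => x;
  rewrite inE/= in_itv/= => /andP[ax xa]; rewrite fg.
Qed.

Definition measurableC f := measurable_fun `]- a, a[ (fun x => Re (f x)) /\
  measurable_fun `]- a, a[ (fun x => Im (f x)).

Lemma integrableC_measurable f : integrableC a f -> measurableC f.
Proof.
move=> [rf im]; split.
  by apply/measurable_EFinP; exact: measurable_int rf.
by apply/measurable_EFinP; exact: measurable_int im.
Qed.

Lemma measurableCM f g : measurableC f -> measurableC g ->
  measurableC (fun x => f x * g x).
Proof.
move=> [rf im] [rg ig]; split.
  rewrite (_ : (fun x => _) = fun x => Re (f x) * Re (g x) - Im (f x) * Im (g x)).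
    by apply: measurable_funB; exact: measurable_funM.
  by apply/funext => x; rewrite ReM.
rewrite (_ : (fun x => _) = fun x => Re (f x) * Im (g x) + Im (f x) * Re (g x)).
  by apply: measurable_funD; exact: measurable_funM.
by apply/funext => x; rewrite ImM.
Qed.

Lemma ae_eq_integralC f g : measurableC f -> measurableC g ->
  {ae mu, forall x, x \in `]- a, a[ -> f x = g x} ->
  integralC a f = integralC a g.
Proof.
move=> [rf im] [rg ig] fg; apply: complexP => /=; apply: ae_eq_Rintegral => //;
  by apply: ae_impl fg => x H Ix; rewrite H.
Qed.

Lemma ae_eq_cprimitive F f g : cprimitive F f -> integrableC a g ->
  {ae mu, forall x, x \in `]- a, a[ -> f x = g x} -> cprimitive F g.
Proof.
move=> [rF iF] [rg ig] fg.
by split; [apply: ae_eq_primitive rF rg _|apply: ae_eq_primitive iF ig _];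
  apply: ae_impl fg => x H Ix; rewrite H.
Qed.

(** Up to a null set, u is a primitive F of its weak derivative g. Testing with p'
turns the equation into the fact that g has weak derivative q F + f,
so g itself agrees almost everywhere with a primitive G of q F + f. *)
Lemma weak_solution_cprimitive q f u : integrableC a q -> integrableC a f ->
  weak_solution a q f u -> exists F G, [/\ cprimitive F G,
    cprimitive G (fun x => q x * F x + f x) &
    {ae mu, forall x, x \in `]- a, a[ -> u x = F x}].
Proof.
move=> qi fi [[ui [g [gi ug]]] wu].
have [F Fg uF] := weak_derivative_cprimitive ui gi ug.
have cF := cprimitive_continuous Fg.
have qFi := integrableC_continuousM cF qi.
have hi := integrableCD qFi fi.
have [|G Gh gG] := weak_derivative_cprimitive gi hi.
  move=> p tp; have tp' := test_derive1 tp.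
  have cp := test_continuous (n := 0) tp.
  have := wu p tp; rewrite [X in X - _](ug _ tp') => E.
  have -> : integralC a (fun x => (q x * F x + f x) * (p x)%:C%C) =
    integralC a (fun x => q x * F x * (p x)%:C%C) +
    integralC a (fun x => f x * (p x)%:C%C).
    rewrite -integralCD; [|exact: integrableC_test..].
    by apply: eq_integralC => x _ _; rewrite mulrDl.
  rewrite -E.
  have -> : integralC a (fun x => q x * F x * (p x)%:C%C) =
     integralC a (fun x => q x * u x * (p x)%:C%C).
    have mp : measurableC (fun x => (p x)%:C%C).
      apply/integrableC_measurable/continuousC_integrable; split => /=.
        by apply/continuousIP; exact: continuous_subspaceT.
      exact: continuousI_cst.
    have mq := integrableC_measurable qi.
    apply: ae_eq_integralC; [by do 2 apply: measurableCM => //;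
      exact/integrableC_measurable/continuousC_integrable| |].
      by do 2 apply: measurableCM => //; exact/integrableC_measurable.
    by apply: ae_impl uF => x H Ix; rewrite H.
  by ring.
exists F, G; split => //; apply: ae_eq_cprimitive Fg _ gG.
exact/continuousC_integrable/(cprimitive_continuous Gh).
Qed.

Lemma cprimitive_weak_solution q f u v : integrableC a q -> integrableC a f ->
  cprimitive u v -> cprimitive v (fun x => q x * u x + f x) ->
  weak_solution a q f u.
Proof.
move=> qi fi uv vh.
have cu := cprimitive_continuous uv; have cv := cprimitive_continuous vh.
split.
  split; first exact: continuousC_integrable.
  exists v; split; first exact: continuousC_integrable.
  exact: cprimitive_weak_derivative.
move=> p tp; have tp' := test_derive1 tp.
have cp := test_continuous (n := 0) tp.
rewrite [X in X - _](cprimitive_weak_derivative uv tp').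
rewrite (cprimitive_weak_derivative vh tp) opprK.
have -> : integralC a (fun x => (q x * u x + f x) * (p x)%:C%C) =
    integralC a (fun x => q x * u x * (p x)%:C%C) +
    integralC a (fun x => f x * (p x)%:C%C).
  rewrite -integralCD; last 2 first.
  - by apply: integrableC_test => //; exact: integrableC_continuousM.
  - exact: integrableC_test.
  by apply: eq_integralC => x _ _; rewrite mulrDl.
by ring.
Qed.

End ComplexPrimitives.

(** * One-sided derivatives and continuously differentiable solutions *)

Section Classical.
Context {R : realType}.
Notation mu := (@lebesgue_measure R).
Variable a : R.
Hypothesis a0 : 0 < a.
Implicit Types (f g h F G H u v : R -> R[i]) (x y d : R).
Local Notation Re := (@complex.Re R).
Local Notation Im := (@complex.Im R).
Local Notation cprimitive := (cprimitive a).

Lemma cvg_norm1P (T : Type) (K : set_system T) (f : T -> R[i]^o) (l : R[i]) :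
  Filter K -> (f @ K --> (l : R[i]^o)) <->
  (forall e : R, 0 < e -> \forall x \near K, norm1 (f x - l) < e).
Proof.
move=> FK; split=> [/cvgrPdist_le fl e e0|fl].
  have e0' : 0 < (e / 3)%:C%C :> R[i] by rewrite ltcR divr_gt0.
  have := fl _ e0'; apply: filterS => x; rewrite distrC => /norm1_le_normc.
  by move=> /le_lt_trans; apply; lra.
apply/cvgrPdist_le => e e0.
have re0 : 0 < Re e by move: e0; rewrite ltcE => /andP[].
have := fl _ re0; apply: filterS => x xe; rewrite distrC.
apply: (le_trans (normc_le_norm1 _)); rewrite -[e]RRe_real ?gtr0_real//.
by rewrite lecR ltW.
Qed.

(** The difference quotients are studied along this filter, which is one-sided at
the two ends. *)
Lemma near_dnbhsI x (P : R -> Prop) :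
  (\forall y \near within `[- a, a] x^', P y) <->
  exists2 d, 0 < d & forall y, - a <= y -> y <= a -> `|y - x| < d -> y != x -> P y.
Proof.
split=> [|[d d0 dP]].
  rewrite !near_withinE => -[d /= d0 dP]; exists d => // y ay ya yx nyx.
  by apply: dP => //=; [rewrite distrC|rewrite in_itv/= ay ya].
rewrite !near_withinE; exists d => // y /= yx nyx; rewrite in_itv/= => /andP[ay ya].
by apply: dP => //; rewrite distrC.
Qed.

Lemma dnbhsI_proper x : - a <= x -> x <= a ->
  ProperFilter (within `[- a, a] x^').
Proof.
move=> ax xa; apply: Build_ProperFilter => /near_dnbhsI[d d0 dF].
have [xlt|xge] := ltP x a.
  pose y := Num.min a (x + d / 2).
  have xy : x < y by rewrite lt_min xlt/= ltrDl divr_gt0.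
  have yle : y <= x + d / 2 by rewrite ge_min lexx orbT.
  apply: (dF y); [by rewrite (le_trans ax)// ltW| by rewrite ge_min lexx| |].
    by rewrite gtr0_norm ?subr_gt0//; lra.
  by rewrite gt_eqF.
pose y := Num.max (- a) (x - d / 2).
have Nax : - a < x by have := a0; lra.
have yx : y < x by rewrite gt_max Nax/= gtrBl divr_gt0.
have ley : x - d / 2 <= y by rewrite le_max lexx orbT.
apply: (dF y); [by rewrite le_max lexx|by rewrite (le_trans (ltW yx))| |].
  by rewrite distrC gtr0_norm ?subr_gt0//; lra.
by rewrite lt_eqF.
Qed.

(** The factor 1 is kept by integrating the two parts separately and adding, since
the norm is the sum of the absolute values of the parts. *)
Lemma le_cprimitive H h (B b : R -> R) x y : cprimitive H h -> primitive a B b ->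
  - a <= x -> x <= y -> y <= a ->
  (forall t, x < t -> t < y -> norm1 (h t) <= b t) ->
  norm1 (H y - H x) <= B y - B x.
Proof.
move=> [rH iH] Bb ax xy ya hb.
have [ri _] := rH; have [ii _] := iH.
have Pr := antiderivP (integrableI_norm ri).
have Pi := antiderivP (integrableI_norm ii).
have := le_primitive (primitiveD Pr Pi) Bb ax xy ya.
have := le_primitive rH Pr ax xy ya (fun t _ _ => lexx _).
have := le_primitive iH Pi ax xy ya (fun t _ _ => lexx _).
rewrite /norm1 ReD ImD ReN ImN /= => leI leR le.
apply: le_trans (lerD leR leI) _; apply: le_trans (le _) => [|t xt ty].
  by apply: le_trans (ler_norm _); lra.
by rewrite ger0_norm ?addr_ge0//; exact: hb.
Qed.

(** The function F - G(x) t is a primitive of G - G(x), which is small near x. *)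
Lemma cprimitive_diff_quot F G x : cprimitive F G -> continuousC a G ->
  - a <= x -> x <= a ->
  diff_quot F x y @[y --> within `[- a, a] x^'] --> (G x : R[i]^o).
Proof.
move=> FG [rG iG] ax xa.
have pf := dnbhsI_proper ax xa.
apply/cvg_norm1P => e e0; apply/near_dnbhsI.
have e40 : 0 < e / 4 by lra.
have [d1 d10 rd] := rG x ax xa _ e40.
have [d2 d20 id] := iG x ax xa _ e40.
exists (Num.min d1 d2); first by rewrite lt_min d10.
have near_h t : - a <= t -> t <= a -> `|t - x| < Num.min d1 d2 ->
    norm1 (G t + - 1 * G x) <= e / 2.
  rewrite lt_min => at_ ta /andP[td1 td2].
  have := rd t at_ ta td1; have := id t at_ ta td2.
  by rewrite /norm1 mulN1r ReD ImD ReN ImN; lra.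
have idP : cprimitive (fun t => t%:C%C) (cst 1).
  by split; [exact: primitive_id|exact: primitive_cst].
have Hh := cprimitiveD FG (cprimitiveZ (- G x) idP).
have Bb : primitive a (fun t => e / 2 * t) (fun=> e / 2 * 1).
  exact: primitiveZ (primitive_id a).
have key s t : - a <= s -> s < t -> t <= a ->
   (s = x \/ t = x) -> `|t - s| < Num.min d1 d2 ->
   norm1 (F t - F s - G x * (t - s)%:C%C) <= e / 2 * (t - s).
  move=> as_ st ta sx ts.
  have := le_cprimitive Hh Bb as_ (ltW st) ta.
  rewrite -mulrBr => le; apply: le_trans (le _) => [|r sr rt].
    rewrite le_eqVlt; apply/orP; left; apply/eqP; congr norm1.
    by rewrite rmorphB /=; ring.
  rewrite !mulr1 -mulN1r; apply: near_h; [by lra|by lra|].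
  move: ts; rewrite gtr0_norm ?subr_gt0// => ts.
  by case: sx => ?; subst; rewrite ltr_norml; apply/andP; split; lra.
move=> y ay ya yx nyx; rewrite /diff_quot.
have yx0 : (y - x)%:C%C != 0 :> R[i].
  by apply/eqP => -[] /eqP; rewrite subr_eq0 (negbTE nyx).
have -> : (F y - F x) / (y - x)%:C%C - G x =
    (F y - F x - G x * (y - x)%:C%C) * ((y - x)^-1)%:C%C.
  by rewrite rmorphV ?unitfE ?subr_eq0//= [in RHS]mulrBl mulfK.
have yx0' : 0 < `|y - x| by rewrite normr_gt0 subr_eq0.
rewrite norm1Mr normfV ltr_pdivrMr//.
apply: (@le_lt_trans _ _ (e / 2 * `|y - x|)); last first.
  by rewrite ltr_pM2r//; lra.
move: nyx; rewrite neq_lt => /orP[ltyx|ltxy].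
  rewrite ltr0_norm ?subr_lt0// opprB -norm1N.
  have := key y x ay ltyx xa (or_intror erefl).
  rewrite distrC => /(_ yx); congr (_ <= _); congr norm1.
  by rewrite !rmorphB /=; ring.
by rewrite gtr0_norm ?subr_gt0//; apply: key => //; left.
Qed.

Lemma cprimitive_derivI F G x : cprimitive F G -> continuousC a G ->
  - a <= x -> x <= a -> derivI a F x = G x.
Proof.
move=> FG cG ax xa; have pf := dnbhsI_proper ax xa.
apply: cvg_lim; last exact: cprimitive_diff_quot.
exact: norm_hausdorff.
Qed.

Lemma continuousC_within F : continuousC a F ->
  {within `[- a, a], continuous (F : R -> R[i]^o)}.
Proof.
move=> [rF iF]; apply/subspace_continuousP => x /=.
rewrite in_itv/= => /andP[ax xa].
apply/cvg_norm1P => e e0; have e20 : 0 < e / 2 by lra.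
have [d1 d10 rd] := rF x ax xa _ e20; have [d2 d20 id] := iF x ax xa _ e20.
rewrite near_withinE; exists (Num.min d1 d2) => /=; first by rewrite lt_min d10.
move=> t /=; rewrite distrC lt_min => /andP[td1 td2].
rewrite in_itv/= => /andP[at_ ta].
have := rd t at_ ta td1; have := id t at_ ta td2.
by rewrite /norm1 ReD ImD ReN ImN; lra.
Qed.

Lemma cprimitive_C1I F G : cprimitive F G -> continuousC a G -> C1I a F.
Proof.
move=> FG cG; split=> [x|].
  rewrite in_itv/= => /andP[ax xa].
  by apply/cvg_ex; exists (G x); exact: cprimitive_diff_quot.
apply/subspace_continuousP => x /= Jx.
have /subspace_continuousP/(_ x Jx) := continuousC_within cG.
move: Jx; rewrite in_itv/= => /andP[ax xa].
rewrite [X in _ -> _ --> X](cprimitive_derivI FG cG ax xa).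
apply: cvg_trans; apply: near_eq_cvg; rewrite near_withinE; near=> t.
rewrite /= in_itv/= => /andP[at_ ta].
by apply/esym; apply: (cprimitive_derivI FG cG).
Unshelve. all: by end_near. Qed.

(** A nonempty open interval has positive measure, so it is not contained in a null
set. *)
Lemma ae_dense (P : R -> Prop) x d : {ae mu, forall y, y \in `]- a, a[ -> P y} ->
  - a <= x -> x <= a -> 0 < d ->
  exists y, [/\ - a < y, y < a, `|y - x| < d & P y].
Proof.
move=> [A [mA A0 sA]] ax xa d0; apply: contrapT => nP.
pose l := Num.max (- a) (x - d); pose r := Num.min a (x + d).
have lr : l < r.
  rewrite lt_min !gt_max; have := a0 => ha.
  by apply/andP; split; apply/andP; split; lra.
have : (mu `]l, r[ <= mu A)%E.
  apply: le_measure; rewrite ?inE//.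
  move=> y /=; rewrite in_itv/= gt_max lt_min => /andP[/andP[ay xy] /andP[ya yx]].
  apply: sA => /= PI; apply: nP; exists y; split => //.
    by rewrite ltr_norml; apply/andP; split; lra.
  by apply: PI; rewrite in_itv/= ay ya.
rewrite [mu A]A0 /= lebesgue_measure_itv/= lte_fin lr -EFinB lee_fin.
by rewrite leNgt subr_gt0 lr.
Qed.

Lemma diff_quot_continuous u x : - a <= x -> x <= a ->
  cvg (diff_quot u x y @[y --> within `[- a, a] x^']) ->
  forall e, 0 < e -> exists2 d, 0 < d & forall y, - a <= y -> y <= a ->
    `|y - x| < d -> norm1 (u y - u x) < e.
Proof.
move=> ax xa /cvg_ex[l ul] e e0; have pf := dnbhsI_proper ax xa.
have /cvg_norm1P/(_ 1 ltr01)/near_dnbhsI[d d0 dl] := ul.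
have C0 : 0 < norm1 l + 1 by rewrite ltr_wpDl// norm1_ge0.
exists (Num.min d (e / (norm1 l + 1))).
  by rewrite lt_min d0 divr_gt0.
move=> y ay ya; rewrite lt_min => /andP[yd ye].
have [->|nyx] := eqVneq y x; first by rewrite subrr norm10.
have yx0 : (y - x)%:C%C != 0 :> R[i].
  by apply/eqP => -[] /eqP; rewrite subr_eq0 (negbTE nyx).
have -> : u y - u x = diff_quot u x y * (y - x)%:C%C by rewrite /diff_quot divfK.
rewrite norm1Mr; apply: (@le_lt_trans _ _ ((norm1 l + 1) * `|y - x|)).
  rewrite ler_wpM2r//; have := dl y ay ya yd nyx.
  have := norm1D (diff_quot u x y - l) l; rewrite subrK; lra.
by rewrite mulrC -ltr_pdivlMr.
Qed.

(** Two continuous functions that agree almost everywhere agree everywhere;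
continuity of u comes from its differentiability. *)
Lemma C1I_ae_eq u F : C1I a u -> continuousC a F ->
  {ae mu, forall x, x \in `]- a, a[ -> u x = F x} ->
  forall x, - a <= x -> x <= a -> u x = F x.
Proof.
move=> [du _] [rF iF] uF x ax xa.
apply/eqP; rewrite -subr_eq0; apply/eqP/norm1_eq0/ler_addgt0Pl => e e0.
rewrite addr0.
have e30 : 0 < e / 3 by lra.
have Jx : x \in `[- a, a] by rewrite in_itv/= ax xa.
have [d d0 ud] := diff_quot_continuous ax xa (du x Jx) e30.
have [d1 d10 rd] := rF x ax xa _ e30; have [d2 d20 id] := iF x ax xa _ e30.
have d120 : 0 < Num.min d (Num.min d1 d2) by rewrite !lt_min d0 d10.
have [y [/ltW ay /ltW ya yx uy]] := ae_dense uF ax xa d120.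
move: yx; rewrite !lt_min => /and3P[yd yd1 yd2].
have := ud y ay ya yd; have := rd y ay ya yd1; have := id y ay ya yd2.
have -> : u x - F x = - (u y - u x) + (F y - F x) by rewrite uy; ring.
have := norm1D (- (u y - u x)) (F y - F x); rewrite norm1N.
by rewrite [norm1 (F y - F x)]/norm1 ReD ImD ReN ImN; lra.
Qed.

(** The representative in C^1 is pinned down on all of [-a, a], including the end
points, and its derivative is the second member of the pair of primitives. *)
Lemma C1_weak_solution_cprimitive q f u : integrableC a q -> integrableC a f ->
  C1_weak_solution a q f u ->
  cprimitive u (derivI a u) /\ cprimitive (derivI a u) (fun x => q x * u x + f x).
Proof.
move=> qi fi [C1u wu].
have [F [G [FG Gh uF]]] := weak_solution_cprimitive a0 qi fi wu.
have cG := cprimitive_continuous a0 Gh.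
have uFJ := C1I_ae_eq C1u (cprimitive_continuous a0 FG) uF.
have uG : cprimitive u G.
  by apply: eq_cprimitive FG => // x ax xa; rewrite uFJ.
have dG x : - a <= x -> x <= a -> G x = derivI a u x.
  by move=> ax xa; rewrite (cprimitive_derivI uG cG).
split.
  by apply: eq_cprimitive uG => // x /ltW ax /ltW xa; exact: dG.
by apply: eq_cprimitive Gh => // x /ltW ax /ltW xa; rewrite uFJ.
Qed.

Lemma cprimitive_C1_weak_solution q f u v : integrableC a q -> integrableC a f ->
  cprimitive u v -> cprimitive v (fun x => q x * u x + f x) ->
  C1_weak_solution a q f u.
Proof.
move=> qi fi uv vh; split; last exact: cprimitive_weak_solution vh.
exact: cprimitive_C1I uv (cprimitive_continuous a0 vh).
Qed.

End Classical.

(** * A weighted a priori estimate *)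

(** The integrand in the estimate: nr, ny, ny1 and nz stand for the norms of r, y,
y1 and z, nry for that of r y and nh for that of r y + z. *)
Lemma bielecki_pointwise {R : realFieldType} (nr ny ny1 nz nry nh rho S B w : R) :
  0 <= nr -> 0 <= ny -> 0 <= ny1 -> 0 <= nz -> nry <= nr * ny -> nh <= nry + nz ->
  1 + nr <= rho -> nz <= B * w -> ny + ny1 <= S * w ->
  ny1 + nh <= (S + B) * w * rho.
Proof.
move=> r0 y0 y10 z0 ry rz rho1 zB yS.
have M : (1 + nr) * (ny + ny1 + nz) <= rho * (S * w + B * w).
  by rewrite ler_pM// ?addr_ge0// lerD.
apply: (@le_trans _ _ ((1 + nr) * (ny + ny1 + nz))); last first.
  by apply: le_trans M _; rewrite -mulrDl mulrC.
have m1 : 0 <= nr * ny1 by rewrite mulr_ge0.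
have m2 : 0 <= nr * nz by rewrite mulr_ge0.
by rewrite mulrDl mul1r !mulrDr; lra.
Qed.

Section Bielecki.
Context {R : realType}.
Notation mu := (@lebesgue_measure R).
Variable a : R.
Hypothesis a0 : 0 < a.
Implicit Types (f g h F G H u v y z : R -> R[i]).
Local Notation Re := (@complex.Re R).
Local Notation Im := (@complex.Im R).
Local Notation cprimitive := (cprimitive a).

Lemma continuousID (F G : R -> R) : continuousI a F -> continuousI a G ->
  continuousI a (fun x => F x + G x).
Proof.
move=> /continuousIP cF /continuousIP cG; apply/continuousIP => x.
exact: cvgD (cF x) (cG x).
Qed.

Lemma continuousIM (F G : R -> R) : continuousI a F -> continuousI a G ->
  continuousI a (fun x => F x * G x).
Proof.
move=> /continuousIP cF /continuousIP cG; apply/continuousIP => x.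
exact: cvgM (cF x) (cG x).
Qed.

Lemma continuousI_norm (F : R -> R) : continuousI a F ->
  continuousI a (fun x => `|F x|).
Proof. by move=> cF; apply: (continuousI_comp _ cF); exact: norm_continuous. Qed.

Lemma continuousC_norm1 F : continuousC a F -> continuousI a (fun x => norm1 (F x)).
Proof. by move=> [rF iF]; apply: continuousID; exact: continuousI_norm. Qed.

Lemma integrableI_norm1 f : integrableC a f -> integrableI a (fun x => norm1 (f x)).
Proof. by move=> [rf im]; apply: integrableID; exact: integrableI_norm. Qed.

Variable rho : R -> R.
Hypothesis rho_int : integrableI a rho.
Hypothesis rho0 : forall t, 0 <= rho t.

Definition mass (t : R) : R := antideriv a rho t - antideriv a rho 0.

(** A Bielecki weight: a large N makes integration from 0 a contraction in the
corresponding weighted sup norm, whatever the length of the interval. *)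
Definition weight (N t : R) : R := expR (N * `|mass t|).

Lemma mass_primitive : primitive a mass rho.
Proof.
apply: (eq_primitive _ _ (primitiveB (antiderivP rho_int)
  (primitive_cst a (antideriv a rho 0)))) => x _ _ //=.
by rewrite subr0.
Qed.

Lemma mass0 : mass 0 = 0. Proof. exact: subrr. Qed.

Lemma mass_ge0 t : 0 <= t -> t <= a -> 0 <= mass t.
Proof.
move=> t0 ta; rewrite -mass0; apply: (primitive_monotone mass_primitive) => //.
by have := a0; lra.
Qed.

Lemma mass_le0 t : - a <= t -> t <= 0 -> mass t <= 0.
Proof.
move=> ta t0; rewrite -mass0; apply: (primitive_monotone mass_primitive) => //.
by have := a0; lra.
Qed.

Lemma weight_gt0 N t : 0 < weight N t. Proof. exact: expR_gt0. Qed.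

Lemma continuous_weight N : continuousI a (weight N).
Proof.
apply: (continuousI_comp (f := expR)); first exact: continuous_expR.
apply: continuousIM; first exact: continuousI_cst.
exact/continuousI_norm/(primitive_continuous (ltW a0) mass_primitive).
Qed.

Lemma weight_ge1 N t : 0 <= N -> 1 <= weight N t.
Proof.
move=> N0; rewrite /weight; apply: le_trans (expR_ge1Dx _).
by rewrite lerDl mulr_ge0.
Qed.

(** Let S be the maximum of (|y| + |y1|) / weight. Integrating the equations from 0
gives |y| + |y1| <= (S + B) / N * weight, since the integral of density times
weight between 0 and x is at most weight / N. At a maximum point this reads
S <= (S + B) / N, that is, S <= B / (N - 1). *)
Lemma bielecki_estimate (N B : R) (r y y1 z : R -> R[i]) :
  1 < N -> 0 <= B ->
  cprimitive y y1 -> cprimitive y1 (fun x => r x * y x + z x) ->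
  y 0 = 0 -> y1 0 = 0 ->
  (forall t, - a < t -> t < a -> 1 + norm1 (r t) <= rho t) ->
  (forall t, - a <= t -> t <= a -> norm1 (z t) <= B * weight N t) ->
  forall x, - a <= x -> x <= a ->
    norm1 (y x) + norm1 (y1 x) <= B / (N - 1) * weight N x.
Proof.
move=> N1 B0 yP y1P y00 y10 rrho zB.
pose Z t := norm1 (y t) + norm1 (y1 t).
have cy := cprimitive_continuous a0 yP; have cy1 := cprimitive_continuous a0 y1P.
have cq : continuousI a (fun t => Z t * expR (- (N * `|mass t|))).
  apply: continuousIM; first by apply: continuousID; exact: continuousC_norm1.
  apply: (continuousI_comp (f := fun t => expR (- t))
    (F := fun t => N * `|mass t|)).
    move=> t; apply: continuous_comp; first exact: continuousN.
    exact: continuous_expR.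
  apply: continuousIM; first exact: continuousI_cst.
  exact/continuousI_norm/(primitive_continuous (ltW a0) mass_primitive).
have [x0 Jx0 maxx0] := EVT_max (opp_le_pos a0) (proj1 (continuousIP a _) cq).
pose S := Z x0 * expR (- (N * `|mass x0|)).
have ZS t : - a <= t -> t <= a -> Z t <= S * weight N t.
  move=> at_ ta; have := maxx0 t; rewrite in_itv/= at_ ta => /(_ isT).
  by rewrite expRN ler_pdivrMr ?expR_gt0.
have Zx0 : Z x0 = S * weight N x0.
  by rewrite /S /weight expRN divfK// gt_eqF// expR_gt0.
have S0 : 0 <= S by rewrite mulr_ge0 ?expR_ge0// addr_ge0// norm1_ge0.
have P1 := antiderivP (integrableI_norm1 (cprimitive_integrable yP)).
have P2 := antiderivP (integrableI_norm1 (cprimitive_integrable y1P)).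
(* Used with c = N on the right of 0 and c = - N on its left: the weight is
   exp (c * mass) there. *)
have incr (c s t : R) : c != 0 -> - a <= s -> s <= t -> t <= a ->
    (forall u : R, s < u -> u < t -> c * mass u = N * `|mass u|) ->
    norm1 (y t - y s) + norm1 (y1 t - y1 s) <=
    (S + B) / c * expR (c * mass t) - (S + B) / c * expR (c * mass s).
  move=> c0 as_ st ta cN.
  have EP := primitiveZ ((S + B) / c)
    (primitive_exp (ltW a0) (primitiveZ c mass_primitive)).
  have l1 := le_cprimitive yP P1 as_ st ta (fun _ _ _ => lexx _).
  have l2 := le_cprimitive y1P P2 as_ st ta (fun _ _ _ => lexx _).
  apply: (le_trans (lerD l1 l2)).
  have := le_primitive (primitiveD P1 P2) EP as_ st ta.
  move=> le; apply: le_trans (le _) => [|u su ut].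
    by apply: le_trans (ler_norm _); rewrite /= opprD addrACA.
  rewrite /= ger0_norm ?addr_ge0 ?norm1_ge0//.
  have -> : (S + B) / c * (expR (c * mass u) * (c * rho u)) =
      (S + B) * weight N u * rho u.
    by rewrite /weight cN//; field.
  have au : - a < u := le_lt_trans as_ su.
  have ua : u < a := lt_le_trans ut ta.
  have := ZS u (ltW au) (ltW ua); have := zB u (ltW au) (ltW ua).
  have := rrho u au ua.
  have := norm1D (r u * y u) (z u); have := norm1M (r u) (y u).
  have := norm1_ge0 (r u); have := norm1_ge0 (y u); have := norm1_ge0 (y1 u).
  move=> y10' yu0 ru0 ry ryz rho1 zBu ZSu.
  exact: (bielecki_pointwise ru0 yu0 y10' (norm1_ge0 _) ry ryz rho1 zBu ZSu).
have N0 : 0 < N by lra.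
have NneN0 : - N != 0 by rewrite oppr_eq0 gt_eqF.
have claim x : - a <= x -> x <= a -> Z x <= (S + B) / N * weight N x.
  move=> ax xa; have SB0 : 0 <= (S + B) / N.
    by rewrite divr_ge0 ?addr_ge0// ltW.
  have [x_ge0|/ltW x_le0] := leP 0 x.
    have Na0 : - a <= 0 by rewrite oppr_le0 ltW.
    have := incr N 0 x (lt0r_neq0 N0) Na0 x_ge0 xa.
    rewrite y00 y10 !subr0 mass0 mulr0 expR0 mulr1 => H.
    rewrite /weight ger0_norm ?mass_ge0//.
    suff : Z x <= (S + B) / N * expR (N * mass x) - (S + B) / N by lra.
    apply: H => u u0 ux; rewrite ger0_norm// mass_ge0//; lra.
  have a_ge0 := ltW a0.
  have := incr (- N) x 0 NneN0 ax x_le0 a_ge0.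
  rewrite y00 y10 !sub0r !norm1N mass0 mulr0 expR0 mulr1 invrN mulrN => H.
  rewrite /weight ler0_norm ?mass_le0//.
  suff : Z x <= - ((S + B) / N) - - ((S + B) / N) * expR (- N * mass x).
    rewrite mulrN -mulNr; move: ((S + B) / N) SB0 (expR _) (Z x) => k k0 E zx.
    by rewrite mulNr opprK; lra.
  apply: H => u ux u0; rewrite ler0_norm ?mulNr ?mulrN// mass_le0//; lra.
have Sle : S <= B / (N - 1).
  have [x0l x0r] : - a <= x0 /\ x0 <= a by move: Jx0; rewrite in_itv/= => /andP.
  have := claim x0 x0l x0r.
  rewrite Zx0 ler_pM2r ?weight_gt0// ler_pdivlMr// ler_pdivlMr ?subr_gt0//.
  by rewrite mulrBr mulr1; lra.
move=> x ax xa; apply: (le_trans (ZS x ax xa)).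
by rewrite ler_wpM2r// ltW// weight_gt0.
Qed.

End Bielecki.

(** * Uniformly convergent series and limits of primitives *)

Section UniformSeries.
Context {R : realType}.
Local Notation Re := (@complex.Re R).
Local Notation Im := (@complex.Im R).
Variables (D : set R) (T : nat -> R -> R[i]) (C : R).
Hypothesis C0 : 0 <= C.
Hypothesis TC : forall k x, D x -> norm1 (T k x) <= C * 2^-1 ^+ k.

Definition psum (n : nat) (x : R) : R[i]^o := \sum_(0 <= k < n) T k x.

(** The sum of the geometric bounds from rank n on. *)
Definition gtail (n : nat) : R := geometric (C * 2) 2^-1 n.

Lemma half_lt1 : `|2^-1 : R| < 1.
Proof. by rewrite ger0_norm// invf_lt1// ltr1n. Qed.

Lemma cvg_gtail : gtail @ \oo --> (0 : R).
Proof. exact: cvg_geometric half_lt1. Qed.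

Lemma gtail_ge0 n : 0 <= gtail n.
Proof. by rewrite /gtail geometric_ge0// mulr_ge0. Qed.

Lemma gtailS n : gtail n.+1 = gtail n - C * 2^-1 ^+ n.
Proof. by rewrite /gtail /= exprS; field. Qed.

Lemma psum_increment n k x : D x ->
  norm1 (psum (n + k) x - psum n x) <= gtail n - gtail (n + k).
Proof.
move=> Dx; elim: k => [|k IH]; first by rewrite addn0 !subrr norm10.
rewrite addnS /psum big_nat_recr //= -/(psum _ x) gtailS.
have -> : psum (n + k) x + T (n + k)%N x - psum n x =
   (psum (n + k) x - psum n x) + T (n + k)%N x by ring.
by have := norm1D (psum (n + k) x - psum n x) (T (n + k)%N x);
  have := TC (n + k) Dx; lra.
Qed.

(** Used for the real and for the imaginary part, to obtain convergence in R[i]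
from the completeness of the real line. *)
Lemma cvg_real_part (f : R[i] -> R) x : D x ->
  (forall z w, f (z + w) = f z + f w) -> f 0 = 0 ->
  (forall z, `|f z| <= norm1 z) ->
  cvg ((f (psum n x) : R) @[n --> \oo]).
Proof.
move=> Dx fD f0 fle.
have -> : (fun n => f (psum n x)) = series (fun k => f (T k x)).
  apply/funext => n; rewrite /psum /series /=.
  by apply: (big_ind2 (fun z r => f z = r)) => // z1 r1 z2 r2 <- <-.
apply: normed_cvg.
apply: (series_le_cvg (v_ := geometric C 2^-1)).
- by move=> n /=.
- by move=> n; exact: geometric_ge0.
- by move=> n; apply: le_trans (fle _) (TC n Dx).
- exact: is_cvg_geometric_series half_lt1.
Qed.

Lemma psum_cvg x : D x -> exists l : R[i], psum n x @[n --> \oo] --> (l : R[i]^o).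
Proof.
move=> Dx.
have /cvg_ex[/= r rP] : cvg ((Re (psum n x) : R) @[n --> \oo]).
  apply: cvg_real_part => // [z w|z]; first exact: ReD.
  by rewrite lerDl.
have /cvg_ex[/= i iP] : cvg ((Im (psum n x) : R) @[n --> \oo]).
  apply: cvg_real_part => // [z w|z]; first exact: ImD.
  by rewrite lerDr.
exists (Complex r i); apply/cvg_norm1P => e e0.
have e20 : 0 < e / 2 by lra.
near=> n.
have h1 : `|r - Re (psum n x)| < e / 2.
  by near: n; exact: ((cvgrPdist_lt _ _).1 rP _ e20).
have h2 : `|i - Im (psum n x)| < e / 2.
  by near: n; exact: ((cvgrPdist_lt _ _).1 iP _ e20).
by rewrite -norm1N opprB /norm1 ReD ImD ReN ImN /=; lra.
Unshelve. all: by end_near. Qed.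

Lemma psum_tail x (l : R[i]) n : D x -> psum n x @[n --> \oo] --> (l : R[i]^o) ->
  norm1 (psum n x - l) <= gtail n.
Proof.
move=> Dx /cvg_norm1P cl; apply/ler_addgt0Pl => e e0.
have [m _ ml] := cl _ e0.
have := ml (n + m)%N (leq_addl _ _) => /= le.
have -> : psum n x - l = - (psum (n + m) x - psum n x) + (psum (n + m) x - l).
  by ring.
have := norm1D (- (psum (n + m) x - psum n x)) (psum (n + m) x - l).
rewrite norm1N; have := psum_increment n m Dx; have := gtail_ge0 (n + m); lra.
Qed.

(** The explicit bound on the remainder is kept because the passage to the limit in
the differential equation uses it. *)
Lemma psum_uniform :
  {uniform D, psum @ \oo --> (fun x => lim (psum n x @[n --> \oo]) : R[i]^o)} /\
  forall x n, D x -> norm1 (psum n x - lim (psum n x @[n --> \oo])) <= gtail n.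
Proof.
have tail x n : D x -> norm1 (psum n x - lim (psum n x @[n --> \oo])) <= gtail n.
  move=> Dx; have [l cl] := psum_cvg Dx.
  rewrite (cvg_lim _ cl); last exact: norm_hausdorff.
  exact: psum_tail.
split=> // P /uniform_nbhs[E [entE EP]].
move: entE; rewrite -entourage_ballE => -[e /= e0 eE].
have re0 : 0 < Re e by move: e0; rewrite ltcE => /andP[].
near=> n; apply: EP => /= x Dx; apply: eE => /=.
rewrite -ball_normE /ball_/= -[e]RRe_real ?gtr0_real// distrC.
apply: (le_lt_trans (normc_le_norm1 _)); rewrite ltcR.
apply: (le_lt_trans (tail x n Dx)).
have := gtail_ge0 n; have : `|0 - gtail n| < Re e.
  by near: n; exact: ((cvgrPdist_lt _ _).1 cvg_gtail _ re0).
by rewrite sub0r normrN => + g0; rewrite ger0_norm.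
Unshelve. all: by end_near. Qed.

End UniformSeries.

Section UniformLimits.
Context {R : realType}.
Variable a : R.
Hypothesis a0 : 0 < a.
Local Notation Re := (@complex.Re R).
Local Notation Im := (@complex.Im R).
Implicit Types (S h : nat -> R -> R[i]) (rho e : R).

Lemma continuousC_norm1P (F : R -> R[i]) : continuousC a F <->
  forall c, - a <= c -> c <= a -> forall e, 0 < e ->
  exists2 d, 0 < d & forall t, - a <= t -> t <= a -> `|t - c| < d ->
    norm1 (F t - F c) < e.
Proof.
split=> [[rF iF] c ac ca e e0|cF].
  have e20 : 0 < e / 2 by lra.
  have [d1 d10 rd] := rF c ac ca _ e20; have [d2 d20 id] := iF c ac ca _ e20.
  exists (Num.min d1 d2) => [|t at_ ta]; first by rewrite lt_min d10.
  rewrite lt_min => /andP[td1 td2].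
  have := rd t at_ ta td1; have := id t at_ ta td2.
  by rewrite /norm1 ReD ImD ReN ImN; lra.
split=> c ac ca e e0; have [d d0 dF] := cF c ac ca e e0;
  exists d => // t at_ ta td; have := dF t at_ ta td;
  rewrite /norm1 ReD ImD ReN ImN;
  [have := normr_ge0 (Im (F t) - Im (F c))|have := normr_ge0 (Re (F t) - Re (F c))];
  lra.
Qed.

Lemma uniform_limit_continuous S (eps : nat -> R) (L : R -> R[i]) :
  eps @ \oo --> (0 : R) -> (forall n, continuousC a (S n)) ->
  (forall n t, - a <= t -> t <= a -> norm1 (S n t - L t) <= eps n) ->
  continuousC a L.
Proof.
move=> e0 cS SL; apply/continuousC_norm1P => c ac ca e ep.
have e30 : 0 < e / 3 by lra.
have [n _ /(_ n (leqnn n)) /=] := (cvgrPdist_lt _ _).1 e0 _ e30.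
rewrite sub0r normrN => en; have {}en := le_lt_trans (ler_norm _) en.
have [d d0 dS] := (continuousC_norm1P (S n)).1 (cS n) c ac ca _ e30.
exists d => // t at_ ta td; have := dS t at_ ta td.
have := SL n t at_ ta; have := SL n c ac ca.
have -> : L t - L c = - (S n t - L t) + ((S n t - S n c) + (S n c - L c)) by ring.
have := norm1D (- (S n t - L t)) ((S n t - S n c) + (S n c - L c)).
have := norm1D (S n t - S n c) (S n c - L c).
by rewrite norm1N; lra.
Qed.

(** The derivatives need only converge relatively to an integrable rho: the
coefficient q is integrable and possibly unbounded, and q S_n converges to q L
in this sense. *)
Lemma cprimitive_limit S h (eps : nat -> R) (L H : R -> R[i]) (rho : R -> R) :
  eps @ \oo --> (0 : R) -> integrableI a rho -> integrableC a H ->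
  (forall n, cprimitive a (S n) (h n)) ->
  (forall n t, - a <= t -> t <= a -> norm1 (S n t - L t) <= eps n) ->
  (forall n t, - a < t -> t < a -> norm1 (h n t - H t) <= eps n * rho t) ->
  cprimitive a L H.
Proof.
move=> e0 ri Hi Sh SL hH.
have [F FH] := cprimitive_exists Hi.
have Bb := antiderivP ri; set B := antideriv a rho in Bb.
have key x y : - a <= x -> x <= y -> y <= a -> L y - L x = F y - F x.
  move=> ax xy ya; apply/eqP; rewrite -subr_eq0; apply/eqP/norm1_eq0.
  have xa := le_trans xy ya; have ay := le_trans ax xy.
  have le n : norm1 (L y - L x - (F y - F x)) <= eps n * (2 + (B y - B x)).
    have P := cprimitiveD (Sh n) (cprimitiveZ (- 1) FH).
    have := le_cprimitive P (primitiveZ (eps n) Bb) ax xy ya.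
    rewrite -mulrBr => le1.
    have {le1} : norm1 (S n y + -1 * F y - (S n x + -1 * F x)) <= eps n * (B y - B x).
      by apply: le1 => t xt ty; rewrite mulN1r; apply: hH;
        [exact: le_lt_trans xt|exact: lt_le_trans ty _].
    have := SL n x ax xa; have := SL n y ay ya.
    set A := S n y + _ - _.
    have -> : L y - L x - (F y - F x) = A + ((S n x - L x) - (S n y - L y)).
      by rewrite /A; ring.
    have := norm1D A ((S n x - L x) - (S n y - L y)).
    have := norm1B (S n x - L x) (S n y - L y).
    rewrite mulrDr; lra.
  have cl : eps n * (2 + (B y - B x)) @[n --> \oo] --> 0 * (2 + (B y - B x)).
    by apply: cvgM => //; exact: cvg_cst.
  rewrite mul0r in cl.
  apply/ler_addgt0Pl => e ep; rewrite addr0.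
  have [n _ /(_ n (leqnn n)) /=] := (cvgrPdist_lt _ _).1 cl _ ep.
  by rewrite sub0r normrN => /(le_lt_trans (ler_norm _))/ltW; exact: le_trans.
have [[rHi rF] [iHi iF]] := FH.
split; split => // x y ax xy ya.
  by rewrite -rF// -!ReN -!ReD key.
by rewrite -iF// -!ImN -!ImD key.
Qed.

End UniformLimits.

(** * Series along an L-base *)

Section LBase.
Context {R : realType}.
Notation mu := (@lebesgue_measure R).
Variable a : R.
Hypothesis a0 : 0 < a.
Variable q : R -> R[i].
Hypothesis q_int : integrableC a q.
Local Notation cprimitive := (cprimitive a).
Implicit Types (lambda c : R[i]) (u v y : R -> R[i]).

(** It dominates both 1 + |q| and 1 + |q + lambda|, so that the same density serves
for the recursion and for uniqueness. *)
Definition density lambda (t : R) : R := 1 + norm1 (q t) + norm1 lambda.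

Lemma density_integrable lambda : integrableI a (density lambda).
Proof.
apply: integrableID; last exact: integrableI_cst.
by apply: integrableID; [exact: integrableI_cst|exact: integrableI_norm1].
Qed.

Lemma density_ge0 lambda t : 0 <= density lambda t.
Proof. by rewrite !addr_ge0 ?norm1_ge0. Qed.

(** The weighted estimate without source term: the equation is linear with
coefficient q + lambda. *)
Lemma cauchy_unique lambda y y1 : cprimitive y y1 ->
  cprimitive y1 (fun x => q x * y x + lambda * y x) -> y 0 = 0 -> y1 0 = 0 ->
  forall x, - a <= x -> x <= a -> y x = 0 /\ y1 x = 0.
Proof.
move=> yP y1P y00 y10 x ax xa.
have y1P' : cprimitive y1 (fun x => (q x + lambda) * y x + 0).
  by apply: eq_cprimitive y1P => // t _ _; rewrite mulrDl addr0.
have := @bielecki_estimate R a a0 _ (density_integrable lambda)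
  (density_ge0 lambda) 2 0 (fun x => q x + lambda) y y1 (fun=> 0).
have lt12 : 1 < 2 :> R by rewrite ltr1n.
move=> /(_ lt12 (lexx _) yP y1P' y00 y10) H.
have : norm1 (y x) + norm1 (y1 x) <= 0 / (2 - 1) * weight a (density lambda) 2 x.
  apply: H => // t _ _; last by rewrite norm10 mul0r.
  by rewrite /density -addrA lerD2l norm1D.
rewrite !mul0r => le0.
have := norm1_ge0 (y x); have := norm1_ge0 (y1 x) => n1 n2.
by split; apply: norm1_eq0; lra.
Qed.

Variable phi : nat -> R -> R[i].
Hypothesis phi_base : standard_L_base a q phi.
Let dphi k := derivI a (phi k).

Lemma phi_primitive j : (j < 2)%N -> cprimitive (phi j) (dphi j) /\
  cprimitive (dphi j) (fun x => q x * phi j x + 0).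
Proof.
have i0 : integrableC a (fun=> 0) by split; exact: integrableI_cst.
case: phi_base => -[H0 H1 _] _ j2; apply: C1_weak_solution_cprimitive => //.
by case: j j2 => [|[|]].
Qed.

Lemma phi_primitiveS k : cprimitive (phi k.+2) (dphi k.+2) /\
  cprimitive (dphi k.+2)
    (fun x => q x * phi k.+2 x + (k.+2 * k.+1)%N%:R * phi k x).
Proof.
case: phi_base => -[H0 H1 H2] _.
have iphi : integrableC a (phi k).
  case: k => [|[|k]]; [by have [_ [[]]] := H0|by have [_ [[]]] := H1|].
  by have [_ [[]]] := H2 k.+2 isT.
have := H2 k.+2 isT; rewrite !subSS !subn0; apply: C1_weak_solution_cprimitive => //.
have c : continuousC a (cst ((k.+2 * k.+1)%N%:R : R[i])).
  by split; exact: continuousI_cst.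
by have := integrableC_continuousM a0 c iphi;
  apply: integrableC_ext => x _ _; rewrite mulrC.
Qed.

Section Series.
Variables (lambda : R[i]) (j : nat).
Hypothesis j2 : (j < 2)%N.

(** The k-th coefficient y_k of lambda^k: it satisfies y_0'' = q y_0 and
y_(k+1)'' = q y_(k+1) + y_k. *)
Definition term k x : R[i] := phi (2 * k + j) x / (2 * k + j)`!%:R.
Definition dterm k x : R[i] := dphi (2 * k + j) x / (2 * k + j)`!%:R.

Lemma fact_neq0 n : n`!%:R != 0 :> R[i].
Proof. by rewrite pnatr_eq0 -lt0n fact_gt0. Qed.

Lemma term_primitive k : cprimitive (term k) (dterm k).
Proof.
have H : cprimitive (phi (2 * k + j)) (dphi (2 * k + j)).
  case: k => [|k]; first by rewrite muln0 add0n; case: (phi_primitive j2).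
  by rewrite mulnS add2n !addSn; case: (phi_primitiveS (2 * k + j)).
apply: eq_cprimitive (cprimitiveZ ((2 * k + j)`!%:R)^-1 H) => x _ _;
  by rewrite mulrC.
Qed.

Lemma dterm_primitive0 : cprimitive (dterm 0) (fun x => q x * term 0 x).
Proof.
have [_ H] := phi_primitive j2.
have := cprimitiveZ ((2 * 0 + j)`!%:R)^-1 H; apply: eq_cprimitive => x _ _.
  by rewrite /dterm mulrC.
by rewrite /term addr0 mulrC mulrA.
Qed.

(** The factor m (m - 1) in the equation of phi_m turns 1 / m! into 1 / (m - 2)!. *)
Lemma dterm_primitiveS k :
  cprimitive (dterm k.+1) (fun x => q x * term k.+1 x + term k x).
Proof.
rewrite /dterm /term mulnS add2n !addSn.
have [_ H] := phi_primitiveS (2 * k + j).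
have := cprimitiveZ ((2 * k + j).+2`!%:R)^-1 H; apply: eq_cprimitive => x _ _.
  by rewrite mulrC.
have f2 := fact_neq0 (2 * k + j).+2; have f0 := fact_neq0 (2 * k + j).
rewrite mulrDr; congr (_ + _); first by rewrite mulrC mulrA.
have -> : (2 * k + j).+2`!%:R =
    ((2 * k + j).+2 * (2 * k + j).+1)%N%:R * (2 * k + j)`!%:R :> R[i].
  by rewrite -natrM !factS mulnA.
have n2 : ((2 * k + j).+2 * (2 * k + j).+1)%N%:R != 0 :> R[i].
  by rewrite pnatr_eq0.
move: (((2 * k + j).+2 * (2 * k + j).+1)%N%:R) n2 => A A0.
move: ((2 * k + j)`!%:R) f0 => B B0.
by rewrite mulrC -mulf_div divff// mul1r.
Qed.

Lemma term_zero k : term k.+1 0 = 0 /\ dterm k.+1 0 = 0.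
Proof.
case: phi_base => _ /(_ (2 * k.+1 + j)%N); rewrite mulnS => /(_ isT)[h1 h2].
by rewrite /term /dterm /dphi mulnS h1 h2 !mul0r.
Qed.

Let N : R := 2 + 2 * norm1 lambda.

(** The weighted estimate, applied k times. Only the term of rank 0 can have
nonzero Cauchy data at 0; it is merely bounded. *)
Lemma term_bound : exists2 C, 0 <= C & forall k x, - a <= x -> x <= a ->
  norm1 (term k x) + norm1 (dterm k x) <=
  C / (N - 1) ^+ k * weight a (density lambda) N x.
Proof.
have cT k := cprimitive_continuous a0 (term_primitive k).
have cdT : continuousC a (dterm 0) := cprimitive_continuous a0 dterm_primitive0.
have [C C0 CP] := continuousI_bounded (ltW a0)
  (continuousID (continuousC_norm1 (cT 0%N)) (continuousC_norm1 cdT)).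
have l0 := norm1_ge0 lambda.
have N1 : 1 < N by rewrite /N; lra.
exists C; first exact: ltW.
elim=> [x ax xa|k IH x ax xa].
  rewrite expr0 divr1; apply: (le_trans (ler_norm _)).
  apply: (le_trans (CP x ax xa)).
  rewrite ler_peMr ?(ltW C0)//; apply: weight_ge1; lra.
have [t0 dt0] := term_zero k.
have D0 : 0 <= C / (N - 1) ^+ k.
  by rewrite divr_ge0 ?exprn_ge0 ?subr_ge0// ltW.
have -> : C / (N - 1) ^+ k.+1 = C / (N - 1) ^+ k / (N - 1).
  by rewrite exprSr invfM mulrA.
apply: (bielecki_estimate a0 (density_integrable lambda) (density_ge0 lambda) N1 D0
  (term_primitive k.+1) (dterm_primitiveS k) t0 dt0) => // t at_ ta.
  by rewrite /density lerDl norm1_ge0.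
by apply: le_trans (IH t at_ ta); rewrite lerDl norm1_ge0.
Qed.

(** With N = 2 + 2 |lambda|, the ratio |lambda| / (N - 1) is at most 1/2. *)
Lemma series_bound : exists2 C, 0 <= C & forall k x, - a <= x -> x <= a ->
  norm1 (lambda ^+ k * term k x) <= C * 2^-1 ^+ k /\
  norm1 (lambda ^+ k * dterm k x) <= C * 2^-1 ^+ k.
Proof.
have [C C0 CP] := term_bound.
have [W W0 WP] := continuousI_bounded (ltW a0)
  (continuous_weight a0 (density_integrable lambda) N).
have l0 := norm1_ge0 lambda.
have N1 : 0 < N - 1 by rewrite /N; lra.
exists (C * W); first by rewrite mulr_ge0// ltW.
move=> k x ax xa.
have ratio : norm1 lambda / (N - 1) <= 2^-1.
  by rewrite ler_pdivrMr// /N; lra.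
suff key z : norm1 z <= norm1 (term k x) + norm1 (dterm k x) ->
    norm1 (lambda ^+ k * z) <= C * W * 2^-1 ^+ k.
  by split; apply: key; rewrite ?lerDl ?lerDr norm1_ge0.
move=> zle; apply: (le_trans (norm1M _ _)).
apply: (@le_trans _ _ (norm1 lambda ^+ k * (C / (N - 1) ^+ k * W))).
  rewrite ler_pM ?norm1_ge0 ?norm1X//.
  apply: (le_trans zle); apply: (le_trans (CP k x ax xa)).
  rewrite ler_wpM2l ?divr_ge0 ?exprn_ge0 ?(ltW N1)//.
  exact: le_trans (ler_norm _) (WP x ax xa).
have -> : norm1 lambda ^+ k * (C / (N - 1) ^+ k * W) =
    C * W * (norm1 lambda / (N - 1)) ^+ k.
  by rewrite exprMn exprVn; ring.
rewrite ler_wpM2l ?mulr_ge0 ?(ltW W0)//.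
by rewrite lerXn2r ?nnegrE ?divr_ge0 ?(ltW N1)// invr_ge0.
Qed.

Let S := spps_partial lambda phi j.
Let dS := spps_partial lambda dphi j.

Lemma partialS n x : S n.+1 x = S n x + lambda ^+ n * term n x.
Proof. by rewrite /S /spps_partial big_nat_recr. Qed.

Lemma dpartialS n x : dS n.+1 x = dS n x + lambda ^+ n * dterm n x.
Proof. by rewrite /dS /spps_partial big_nat_recr. Qed.

Lemma partial0 x : S 0 x = 0. Proof. by rewrite /S /spps_partial big_nil. Qed.

Lemma dpartial0 x : dS 0 x = 0. Proof. by rewrite /dS /spps_partial big_nil. Qed.

Lemma partial_primitive n : cprimitive (S n) (dS n).
Proof.
elim: n => [|n IH].
  by apply: eq_cprimitive (cprimitive_cst a 0) => x _ _; rewrite ?partial0 ?dpartial0.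
have := cprimitiveD IH (cprimitiveZ (lambda ^+ n) (term_primitive n)).
by apply: eq_cprimitive => x _ _; rewrite -?partialS -?dpartialS.
Qed.

(** The ranks are shifted by one between the two terms because the k-th term is the
source in the equation of the next one. *)
Lemma dpartial_primitive n :
  cprimitive (dS n.+1) (fun x => q x * S n.+1 x + lambda * S n x).
Proof.
elim: n => [|n IH].
  apply: eq_cprimitive dterm_primitive0 => x _ _.
    by rewrite dpartialS dpartial0 add0r expr0 mul1r.
  by rewrite partialS partial0 expr0 mul1r mulr0 addr0 add0r.
have := cprimitiveD IH (cprimitiveZ (lambda ^+ n.+1) (dterm_primitiveS n)).
apply: eq_cprimitive => x _ _; first by rewrite -dpartialS.
by rewrite [S n.+2 x]partialS [S n.+1 x]partialS exprS; ring.
Qed.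

Lemma partial_at0 n : S n.+1 0 = phi j 0 /\ dS n.+1 0 = dphi j 0.
Proof.
have j1 : j`!%:R = 1 :> R[i] by case: j j2 => [|[|]].
elim: n => [|n [IH1 IH2]].
  rewrite partialS dpartialS partial0 dpartial0 !add0r expr0 !mul1r.
  by rewrite /term /dterm muln0 add0n j1 !divr1.
have [t0 dt0] := term_zero n.
by rewrite partialS dpartialS t0 dt0 !mulr0 !addr0.
Qed.

(** The existence half of the statement, for each parity j, together with the
Cauchy data that identify the sum. *)
Lemma spps_spec : let v := spps lambda phi j in let w := spps lambda dphi j in
  [/\ spps_uniform a lambda phi j, spps_uniform a lambda dphi j,
   cprimitive v w, cprimitive w (fun x => q x * v x + lambda * v x) &
   v 0 = phi j 0 /\ w 0 = dphi j 0].
Proof.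
move=> v w.
have [C C0 CP] := series_bound.
have CP1 k x : `[- a, a]%classic x -> norm1 (lambda ^+ k * term k x) <= C * 2^-1 ^+ k.
  by rewrite /= in_itv/= => /andP[ax xa]; case: (CP k x ax xa).
have CP2 k x : `[- a, a]%classic x -> norm1 (lambda ^+ k * dterm k x) <= C * 2^-1 ^+ k.
  by rewrite /= in_itv/= => /andP[ax xa]; case: (CP k x ax xa).
have [u1 t1] := psum_uniform C0 CP1; have [u2 t2] := psum_uniform C0 CP2.
have {}t1 n x : - a <= x -> x <= a -> norm1 (S n x - v x) <= gtail C n.
  by move=> ax xa; apply: t1; rewrite /= in_itv/= ax xa.
have {}t2 n x : - a <= x -> x <= a -> norm1 (dS n x - w x) <= gtail C n.
  by move=> ax xa; apply: t2; rewrite /= in_itv/= ax xa.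
have cg := cvg_gtail C.
have cS n := cprimitive_continuous a0 (partial_primitive n).
have cdS n : continuousC a (dS n.+1) :=
  cprimitive_continuous a0 (dpartial_primitive n).
have cgS : gtail C n.+1 @[n --> \oo] --> (0 : R) by rewrite (cvg_shiftS (gtail C)).
have cv : continuousC a v := uniform_limit_continuous cg cS t1.
have cw : continuousC a w := uniform_limit_continuous cgS cdS (fun n => t2 n.+1).
have cl : continuousC a (cst lambda) by split; exact: continuousI_cst.
have g0 n := gtail_ge0 C0 n.
have anti n : gtail C n.+1 <= gtail C n.
  by rewrite gtailS gerBl mulr_ge0// exprn_ge0// invr_ge0.
split => //.
- apply: (cprimitive_limit cg (integrableI_cst a 1)
    (continuousC_integrable a0 cw) partial_primitive t1) => n t at_ ta.
  by rewrite mulr1; apply: t2; exact: ltW.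
- have Hi : integrableC a (fun x => q x * v x + lambda * v x).
    apply: integrableCD; first exact: integrableC_continuousM.
    apply: integrableC_continuousM => //.
    exact: continuousC_integrable.
  apply: (cprimitive_limit cg (density_integrable lambda) Hi dpartial_primitive).
    move=> n t at_ ta; exact: le_trans (t2 n.+1 t at_ ta) (anti n).
  move=> n t /ltW at_ /ltW ta.
  have -> : q t * S n.+1 t + lambda * S n t - (q t * v t + lambda * v t) =
     q t * (S n.+1 t - v t) + lambda * (S n t - v t) by ring.
  apply: (le_trans (norm1D _ _)).
  have h1 : norm1 (q t * (S n.+1 t - v t)) <= norm1 (q t) * gtail C n.
    apply: (le_trans (norm1M _ _)); rewrite ler_wpM2l ?norm1_ge0//.
    exact: le_trans (t1 n.+1 t at_ ta) (anti n).
  have h2 : norm1 (lambda * (S n t - v t)) <= norm1 lambda * gtail C n.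
    apply: (le_trans (norm1M _ _)); rewrite ler_wpM2l ?norm1_ge0//.
    exact: t1.
  apply: (le_trans (lerD h1 h2)); rewrite [leRHS]mulrC /density !mulrDl mul1r.
  by have := g0 n; lra.
- have lim_at0 (u : nat -> R[i]^o) (l : R[i]) : (forall n, u n.+1 = l) ->
    lim (u n @[n --> \oo]) = l.
    move=> ul; apply: cvg_lim; first exact: norm_hausdorff.
    rewrite -cvg_shiftS (_ : (fun n => u n.+1) = cst (l : R[i]^o)).
      exact: cvg_cst.
    exact/funext.
  by split; apply: lim_at0 => n; case: (partial_at0 n).
Qed.

End Series.

(** A combination of phi_0 and phi_1 with zero Cauchy data at 0 vanishes everywhere,
so its coefficients vanish when the Wronskian is nonzero at x. If the
determinant at 0 were zero, its cofactors would provide such combinations, and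
all Cauchy data would vanish. *)
Lemma wronskian_at0 :
  (exists x : R, x \in `[- a, a] /\ wronskian a (phi 0%N) (phi 1%N) x <> 0) ->
  phi 0%N 0 * dphi 1%N 0 - dphi 0%N 0 * phi 1%N 0 != 0.
Proof.
move=> [x [+ Wx]]; rewrite in_itv/= => /andP[ax xa].
have [p0 dp0] := @phi_primitive 0%N isT; have [p1 dp1] := @phi_primitive 1%N isT.
(* At x, the products of c and c' with the Wronskian are combinations of the
   values of c phi_0 + c' phi_1 and of its derivative. *)
have comb c c' : c * phi 0%N 0 + c' * phi 1%N 0 = 0 ->
    c * dphi 0%N 0 + c' * dphi 1%N 0 = 0 -> c = 0 /\ c' = 0.
  move=> e de.
  have P := cprimitiveD (cprimitiveZ c p0) (cprimitiveZ c' p1).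
  have dP := cprimitiveD (cprimitiveZ c dp0) (cprimitiveZ c' dp1).
  have [|z dz] := @cauchy_unique 0 _ _ P _ e de x ax xa.
    by apply: eq_cprimitive dP => // t _ _; ring.
  have cW : c * wronskian a (phi 0%N) (phi 1%N) x = 0.
    transitivity ((c * phi 0%N x + c' * phi 1%N x) * dphi 1%N x -
      (c * dphi 0%N x + c' * dphi 1%N x) * phi 1%N x).
      by rewrite /wronskian /dphi; ring.
    by rewrite z dz !mul0r subrr.
  have cW' : c' * wronskian a (phi 0%N) (phi 1%N) x = 0.
    transitivity ((c * dphi 0%N x + c' * dphi 1%N x) * phi 0%N x -
      (c * phi 0%N x + c' * phi 1%N x) * dphi 0%N x).
      by rewrite /wronskian /dphi; ring.
    by rewrite z dz !mul0r subrr.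
  move/eqP: cW; move/eqP: cW'; rewrite !mulf_eq0; move/eqP/negbTE: Wx => ->.
  by rewrite !orbF => /eqP -> /eqP ->.
apply/eqP => D0.
have [||z1 nz0] := comb (phi 1%N 0) (- phi 0%N 0).
- by ring.
- by rewrite -[RHS]oppr0 -D0; ring.
have [||dz1 ndz0] := comb (dphi 1%N 0) (- dphi 0%N 0).
- by rewrite -D0; ring.
- by ring.
have [z0 dz0] : phi 0%N 0 = 0 /\ dphi 0%N 0 = 0.
  by split; apply/eqP; rewrite -oppr_eq0; apply/eqP.
have [] := comb 1 0; rewrite ?z0 ?dz0 ?z1 ?dz1 ?mulr0 ?addr0//.
by move=> /eqP; rewrite oner_eq0.
Qed.

End LBase.

Theorem corollary23 (R : realType) (a : R) (ha : 0 < a)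
    (q : R -> R[i]) (hq : integrableC a q)
    (phi : nat -> R -> R[i]) (hphi : standard_L_base a q phi)
    (hW : exists x : R, x \in `[- a, a] /\
            wronskian a (phi 0%N) (phi 1%N) x <> 0)
    (lambda : R[i]) :
  let v1 := spps lambda phi 0 in
  let v2 := spps lambda phi 1 in
  let dphi := fun k => derivI a (phi k) in
  [/\ spps_uniform a lambda phi 0 /\ spps_uniform a lambda phi 1,
      spps_uniform a lambda dphi 0 /\ spps_uniform a lambda dphi 1,
      forall c1 c2 : R[i],
        let v := fun x => c1 * v1 x + c2 * v2 x in
        C1_weak_solution a q (fun x => lambda * v x) v &
      forall v : R -> R[i],
        weak_solution a q (fun x => lambda * v x) v ->
        exists c1 c2 : R[i],
          {ae @lebesgue_measure R, forall x, x \in `]- a, a[ ->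
             v x = c1 * v1 x + c2 * v2 x}].
Proof.
move=> v1 v2 dphi.
have [u1 du1 P1 dP1 [v10 w10]] := spps_spec ha hq hphi lambda (j := 0) isT.
have [u2 du2 P2 dP2 [v20 w20]] := spps_spec ha hq hphi lambda (j := 1) isT.
have combP c1 c2 := cprimitiveD (cprimitiveZ c1 P1) (cprimitiveZ c2 P2).
have dcombP c1 c2 : cprimitive a
    (fun x => c1 * spps lambda dphi 0 x + c2 * spps lambda dphi 1 x)
    (fun x => q x * (c1 * v1 x + c2 * v2 x) + lambda * (c1 * v1 x + c2 * v2 x)).
  apply: eq_cprimitive (cprimitiveD (cprimitiveZ c1 dP1) (cprimitiveZ c2 dP2)) => //.
  by move=> x _ _; rewrite /v1 /v2; ring.
have scaleI (f : R -> R[i]) : integrableC a f ->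
    integrableC a (fun x => lambda * f x).
  have cl : continuousC a (cst lambda) by split; exact: continuousI_cst.
  move=> fi; have := integrableC_continuousM ha cl fi.
  by apply: integrableC_ext => x _ _; rewrite mulrC.
split=> // [c1 c2 v|v wv].
  apply: (cprimitive_C1_weak_solution ha hq _ (combP c1 c2) (dcombP c1 c2)).
  exact/scaleI/(continuousC_integrable ha)/(cprimitive_continuous ha (combP c1 c2)).
have vi : integrableC a v by have [[]] := wv.
have [F [G [FG Gh vF]]] := weak_solution_cprimitive ha hq (scaleI v vi) wv.
have cF := cprimitive_continuous ha FG.
have {}Gh : cprimitive a G (fun x => q x * F x + lambda * F x).
  apply: ae_eq_cprimitive Gh _ _.
    apply: integrableCD; first exact: integrableC_continuousM.
    exact/scaleI/(continuousC_integrable ha).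
  by apply: ae_impl vF => x H Ix; rewrite H.
have := wronskian_at0 ha hq hphi hW.
set D := (_ - _) => D0.
(* Cramer's rule for the Cauchy data at 0. *)
pose c1 := (F 0 * dphi 1%N 0 - G 0 * phi 1%N 0) / D.
pose c2 := (phi 0%N 0 * G 0 - dphi 0%N 0 * F 0) / D.
exists c1, c2; apply: ae_impl vF => x H Ix; rewrite H//.
have Y := cprimitiveD FG (cprimitiveZ (- 1) (combP c1 c2)).
have dY := cprimitiveD Gh (cprimitiveZ (- 1) (dcombP c1 c2)).
move: Ix; rewrite in_itv/= => /andP[/ltW ax /ltW xa].
have [|||z _] := cauchy_unique ha hq (lambda := lambda) Y _ _ _ ax xa.
- by apply: eq_cprimitive dY => // t _ _; rewrite /v1 /v2; ring.
- by rewrite v10 v20 /c1 /c2 /D /dphi; field.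
- by rewrite w10 w20 /c1 /c2 /D /dphi; field.
- by apply/eqP; rewrite -subr_eq0; move: z; rewrite mulN1r => ->.
Qed.
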